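(* Let $\theta$ be an inner function. For any $g \in L^2(\mathbb{T})$ there exists $\tilde{g} \in L^2(\mathbb{T})$ such that $A_g^\theta = A_{\tilde{g}}^\theta$ and $\tilde{g}^{-1} \in L^\infty(\mathbb{T})$.
   Context: $\mathbb{T}$ is the unit circle, $L^2 = L^2(\mathbb{T})$, and $H^2$ is the Hardy space of the unit disc, identified via boundary values with a closed subspace of $L^2$. $\overline{H^2_0} = \{\overline{f} : f \in H^2, f(0)=0\}$. For an inner function $\theta$, the model space is $K_\theta = \theta\overline{H^2_0} \cap H^2$, and $P_\theta : L^2 \to K_\theta$ is the orthogonal projection. For $g \in L^2$, the truncated Toeplitz operator $A_g^\theta$ is the densely defined operator on $K_\theta$ given by $A_g^\theta(f) = P_\theta(gf)$ with domain $\{f \in K_\theta : gf \in L^2\}$. Here $\tilde g^{-1}$ denotes the pointwise reciprocal $1/\tilde g$ (a.e. on $\mathbb{T}$). *)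

(* Defs.v *)
From mathcomp Require Import all_boot all_order all_algebra.
From mathcomp Require Import complex.
From mathcomp Require Import all_classical all_reals all_analysis.

Set Implicit Arguments.
Unset Strict Implicit.
Unset Printing Implicit Defensive.

Import Order.TTheory GRing.Theory Num.Theory.
Import numFieldNormedType.Exports.
Import Normc.

Local Open Scope classical_set_scope.
Local Open Scope ring_scope.
Local Open Scope complex_scope.

(* Functions on the unit circle and functions on the open unit disc are both
   represented by total functions R[i] -> R[i]; only the values on the circle,
   respectively on the disc, are ever used.  Elements of the Lebesgue spaces
   are represented by Borel functions, and identities between them are stated
   almost everywhere. *)

Section Circle.
Context {R : realType}.
Implicit Types (f g u v : R[i] -> R[i]) (p : \bar R).

Definition expi (t : R) : R[i] := cos t +i* sin t.

Lemma twopi_gt0 : 0 < 2 * pi :> R.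
Proof. by rewrite mulr_gt0 ?pi_gt0. Qed.

(* Normalized arc length on the circle, in the parameter t of expi t. *)
Definition arc_length := uniform_prob twopi_gt0.

Definition ae_circle (P : R[i] -> Prop) : Prop :=
  \forall t \ae arc_length, P (expi t).

Definition measurable_circle f : Prop :=
  measurable_fun setT (fun t : R => complex.Re (f (expi t))) /\
  measurable_fun setT (fun t : R => complex.Im (f (expi t))).

Definition Lp_circle p f : Prop :=
  measurable_circle f /\
  finite_norm arc_length p (fun t : R => normc (f (expi t))).

Definition L2 : set (R[i] -> R[i]) := Lp_circle 2%:E.
Definition Linfty : set (R[i] -> R[i]) := Lp_circle +oo%E.

(* The integral over the circle of u times the conjugate of v. *)
Definition dotL2 u v : R[i] :=
  (\int[arc_length]_t complex.Re (u (expi t) * (v (expi t))^*)) +i*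
  (\int[arc_length]_t complex.Im (u (expi t) * (v (expi t))^*)).

(* Graph of the orthogonal projection of L2 onto a closed subspace K. *)
Definition is_orthoproj (K : set (R[i] -> R[i])) u v : Prop :=
  K v /\ forall w, K w -> dotL2 (u \- v) w = 0.

End Circle.

Section Hardy.
Context {R : realType}.
Implicit Types (a : nat -> R[i]) (F f g h theta : R[i] -> R[i]).

(* The copy R[i]^o of R[i] is the one that carries the topology. *)
Definition is_taylor_disc a F : Prop :=
  forall z : R[i], normc z < 1 ->
    series (fun n => a n * z ^+ n : R[i]^o) @ \oo --> (F z : R[i]^o).

Definition hardy2_disc F : Prop :=
  exists a, is_taylor_disc a F /\ cvgn (series (fun n => normc (a n) ^+ 2)).

Definition hardyinfty_disc F : Prop :=
  (exists a, is_taylor_disc a F) /\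
  exists M : R, forall z : R[i], normc z < 1 -> normc (F z) <= M.

Definition boundary_value F f : Prop :=
  ae_circle (fun z =>
    (F (r%:C * z) : R[i]^o) @[r --> (1 : R)^'-] --> (f z : R[i]^o)).

Definition H2 : set (R[i] -> R[i]) :=
  [set f | L2 f /\ exists F, hardy2_disc F /\ boundary_value F f].

Definition H2_0 : set (R[i] -> R[i]) :=
  [set f | L2 f /\
    exists F, [/\ hardy2_disc F, F 0 = 0 & boundary_value F f]].

(* An inner function, given by its boundary values. *)
Definition inner_function theta : Prop :=
  [/\ Linfty theta,
      exists F, hardyinfty_disc F /\ boundary_value F theta &
      ae_circle (fun z => normc (theta z) = 1)].

Definition model_space theta : set (R[i] -> R[i]) :=
  [set f | H2 f /\
    exists2 h, H2_0 h & ae_circle (fun z => f z = theta z * (h z)^*)].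

Definition tto_dom theta g : set (R[i] -> R[i]) :=
  [set f | model_space theta f /\ L2 (g \* f)].

(* Graph of the truncated Toeplitz operator: tto theta g (f, v) says that f is
   in the domain and that v is (a representative of) the projection of g f. *)
Definition tto theta g : set ((R[i] -> R[i]) * (R[i] -> R[i])) :=
  [set fv | tto_dom theta g fv.1 /\
            is_orthoproj (model_space theta) (g \* fv.1) fv.2].

End Hardy.

(* Main.v *)
From HB Require Import structures.
Require Import Defs.
From mathcomp Require Import all_boot all_order all_algebra.
From mathcomp Require Import complex.
From mathcomp Require Import all_classical all_reals all_analysis.
From mathcomp Require Import measurable_realfun.
From mathcomp Require Import ring lra.

Set Implicit Arguments.
Unset Strict Implicit.
Unset Printing Implicit Defensive.

Import Order.TTheory GRing.Theory Num.Theory.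
Import numFieldNormedType.Exports.
Import Normc.

Local Open Scope classical_set_scope.
Local Open Scope ring_scope.
Local Open Scope complex_scope.

(** Write [mu] for normalized arc length.  The symbol is corrected by
    [gt = g + theta * h], where [h] is a bounded analytic function on the circle
    and [|gt| >= 1] almost everywhere.

    - Such a correction does not change the operator.  If [f] and [k] lie in the
      model space and [k = theta * conj l] with [l] analytic and [l(0) = 0], then
      on the circle [theta * h * f * conj k = h * f * l] because
      [|theta| = 1], and the mean of the analytic product [h * f * l] is its value
      at the origin, which is [0].  Boundedness of [theta * h] keeps the domain
      unchanged.  The mean value computation uses only that [h], [f], [l] are [L2]
      limits of polynomials, those for [l] vanishing at [0]; boundedness of [h]
      allows the three factors to be approximated in turn
      ([analytic_product_mean0], [tto_change_symbol]).  For [f] and [l] the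
      polynomials are the Taylor polynomials: Fatou's lemma, applied first to the
      partial sums and then to the radii increasing to [1], bounds the [L2]
      distance by the tail of the coefficient series ([hardy2_L2_closure]).

    - Since [|theta| = 1], it suffices that the modulus of [h] keeps away from
      that of [g]: take [|h| = 2] where [|g| > 3] and [|h| = 4] elsewhere
      ([separating_function]).

    - An analytic [h] with [|h|^2 * w] constant, for a prescribed weight [w] with
      [1 <= w <= M], comes from Szego's extremal problem: minimize
      [Q p = \int |p|^2 w dmu] among the polynomials with [p(0) = 1].  By the
      parallelogram identity a minimizing sequence is Cauchy; a rapidly minimizing
      one converges almost everywhere, to some [F] that attains the infimum [d]
      ([szego_limit]).  For [m = 1 + s e^(ib) z^n] the products [m * p] are again
      competitors, so [Q (m * F) >= d = Q F], that is,
      [s^2 d + 2 s \int |F|^2 w cos (n t + b) dmu >= 0] for every real [s].  Hence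
      all the nonconstant Fourier coefficients of [|F|^2 w] vanish, and
      [|F|^2 w = d] almost everywhere ([outer_function]).

    - The last step is the uniqueness of Fourier coefficients of a nonnegative
      density ([fourier_unique]).  Indicators of rays in the parameter interval
      are bounded pointwise limits of trigonometric polynomials, so the density
      has the same integrals over rays as a constant, and rays determine a
      measure. *)

(** * Squared modulus of complex numbers *)

Section SquaredModulus.
Context {R : rcfType}.
Implicit Types x y z : R[i].

(** The square of [normc], as a polynomial in the two real components: this form
    gives identities by [ring] and measurability without square roots. *)
Definition sqn z : R := complex.Re z ^+ 2 + complex.Im z ^+ 2.

Lemma sqnE z : sqn z = normc z ^+ 2.
Proof. by case: z => a b; rewrite /sqn /= sqr_sqrtr // addr_ge0 ?sqr_ge0. Qed.

Lemma normcE_sqn z : normc z = Num.sqrt (sqn z).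
Proof. by case: z. Qed.

Lemma normc_ge0 z : 0 <= normc z.
Proof. by case: z => a b; exact: sqrtr_ge0. Qed.

Lemma sqn_ge0 z : 0 <= sqn z.
Proof. by rewrite addr_ge0 ?sqr_ge0. Qed.

Lemma sqnM x y : sqn (x * y) = sqn x * sqn y.
Proof. by rewrite !sqnE normcM exprMn. Qed.

Lemma sqnN x : sqn (- x) = sqn x.
Proof. by rewrite !sqnE normcN. Qed.

Lemma sqn0 : sqn (0 : R[i]) = 0.
Proof. by rewrite /sqn /= expr0n /= addr0. Qed.

Lemma sqn1 : sqn (1 : R[i]) = 1.
Proof. by rewrite /sqn /= expr0n expr1n /= addr0. Qed.

Lemma sqn_real (a : R) : sqn a%:C = a ^+ 2.
Proof. by rewrite /sqn /= expr0n addr0. Qed.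

(** Letting [e] tend to [0] recovers the first term without loss; this stands in
    for the triangle inequality of the [L2] norm. *)
Lemma sqnD_le x y (e : R) : 0 < e ->
  sqn (x + y) <= (1 + e) * sqn x + (1 + e^-1) * sqn y.
Proof.
case: x y => [a b] [c d] e0; rewrite /sqn /=.
have := sqr_ge0 (e * a - c); have := sqr_ge0 (e * b - d) => h1 h2.
have e1 : e * e^-1 = 1 by rewrite mulfV ?gt_eqF.
rewrite -subr_ge0.
have -> : (1 + e) * (a ^+ 2 + b ^+ 2) + (1 + e^-1) * (c ^+ 2 + d ^+ 2) -
  ((a + c) ^+ 2 + (b + d) ^+ 2) = e^-1 * ((e * a - c) ^+ 2 + (e * b - d) ^+ 2).
  by field; rewrite gt_eqF.
by rewrite mulr_ge0 ?addr_ge0 // invr_ge0 ltW.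
Qed.

Lemma sqnD_le2 x y : sqn (x + y) <= 2 * sqn x + 2 * sqn y.
Proof. by have := sqnD_le x y ltr01; rewrite invr1. Qed.

Lemma parallelogram x y :
  sqn (x - y) = 2 * sqn x + 2 * sqn y - sqn (x + y).
Proof. by case: x y => [a b] [c d]; rewrite /sqn /=; ring. Qed.

Lemma normr_Re_le z : `|complex.Re z| <= normc z.
Proof.
by case: z => a b; rewrite /= -sqrtr_sqr ler_wsqrtr // lerDl sqr_ge0.
Qed.

Lemma normr_Im_le z : `|complex.Im z| <= normc z.
Proof.
by case: z => a b; rewrite /= -sqrtr_sqr ler_wsqrtr // lerDr sqr_ge0.
Qed.

Lemma normcM_le x y : normc (x * y) <= 2^-1 * (sqn x + sqn y).
Proof.
rewrite normcM !sqnE; have := sqr_ge0 (normc x - normc y).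
by rewrite sqrrB; lra.
Qed.

(** The quadratic polynomial in [s] behind the Cauchy-Schwarz inequality. *)
Lemma sqn_real_linear (s : R) x y :
  sqn (s%:C * x + y^*) = s ^+ 2 * sqn x + 2 * s * complex.Re (x * y) + sqn y.
Proof. by case: x y => [a b] [c d]; rewrite /sqn /=; ring. Qed.

Lemma Re_add x y : complex.Re (x + y) = complex.Re x + complex.Re y.
Proof. by case: x y => [a b] [c d]. Qed.

Lemma Im_add x y : complex.Im (x + y) = complex.Im x + complex.Im y.
Proof. by case: x y => [a b] [c d]. Qed.

Lemma Re_conj x : complex.Re x^* = complex.Re x.
Proof. by case: x. Qed.

Lemma Im_conj x : complex.Im x^* = - complex.Im x.
Proof. by case: x. Qed.

End SquaredModulus.

(** * Measurability and square integrability of complex functions *)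

Section ComplexMeasurable.
Context d (T : measurableType d) (R : realType).
Implicit Types u v : T -> R[i].

Definition cmeasurable u : Prop :=
  measurable_fun setT (fun t => complex.Re (u t)) /\
  measurable_fun setT (fun t => complex.Im (u t)).

Lemma cmeasurable_cst c : cmeasurable (fun=> c).
Proof. by split; exact: measurable_cst. Qed.

Lemma cmeasurableD u v : cmeasurable u -> cmeasurable v ->
  cmeasurable (fun t => u t + v t).
Proof.
move=> [u1 u2] [v1 v2]; split.
  by under eq_fun do rewrite Re_add; exact: measurable_funD.
by under eq_fun do rewrite Im_add; exact: measurable_funD.
Qed.

Lemma cmeasurableM u v : cmeasurable u -> cmeasurable v ->
  cmeasurable (fun t => u t * v t).
Proof.
move=> [u1 u2] [v1 v2]; split.
  under eq_fun => t.
    rewrite (_ : complex.Re _ = complex.Re (u t) * complex.Re (v t) -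
      complex.Im (u t) * complex.Im (v t)); last by case: (u t) (v t) => ? ? [].
    over.
  by apply: measurable_funB; exact: measurable_funM.
under eq_fun => t.
  rewrite (_ : complex.Im _ = complex.Re (u t) * complex.Im (v t) +
    complex.Im (u t) * complex.Re (v t)); last by case: (u t) (v t) => ? ? [].
  over.
by apply: measurable_funD; exact: measurable_funM.
Qed.

Lemma cmeasurableN u : cmeasurable u -> cmeasurable (fun t => - u t).
Proof.
move=> mu; rewrite (_ : (fun t => - u t) = (fun t => -1 * u t)); last first.
  by apply/funext => t; rewrite mulN1r.
exact: cmeasurableM (cmeasurable_cst _) mu.
Qed.

Lemma cmeasurableB u v : cmeasurable u -> cmeasurable v ->
  cmeasurable (fun t => u t - v t).
Proof. by move=> mu mv; apply: cmeasurableD => //; exact: cmeasurableN. Qed.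

Lemma cmeasurable_conj u : cmeasurable u -> cmeasurable (fun t => (u t)^*).
Proof.
move=> [u1 u2]; split.
  by under eq_fun do rewrite Re_conj.
by under eq_fun do rewrite Im_conj; exact: measurable_funN.
Qed.

Lemma measurable_sqn u : cmeasurable u -> measurable_fun setT (fun t => sqn (u t)).
Proof.
by move=> [u1 u2]; apply: measurable_funD; exact: measurable_funX.
Qed.

Lemma measurable_normc u : cmeasurable u ->
  measurable_fun setT (fun t => normc (u t)).
Proof.
move=> mu; under eq_fun do rewrite normcE_sqn.
apply: (measurableT_comp (continuous_measurable_fun (@sqrt_continuous R))).
exact: measurable_sqn.
Qed.

Lemma cmeasurableV u : cmeasurable u -> cmeasurable (fun t => (u t)^-1).
Proof.
move=> mu; have [u1 u2] := mu.
have mV : measurable_fun setT (fun t => (sqn (u t))^-1).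
  rewrite (_ : (fun _ => _) = (@powR R ^~ (-1)) \o (fun t => sqn (u t))).
  2: by apply/funext => t /=; rewrite powR_inv1 ?sqn_ge0.
  exact: (measurableT_comp (@measurable_powR R (-1)) (measurable_sqn mu)).
split.
  under eq_fun => t.
    rewrite (_ : complex.Re _ = complex.Re (u t) * (sqn (u t))^-1); last first.
      by case: (u t).
    over.
  exact: measurable_funM.
under eq_fun => t.
  rewrite (_ : complex.Im _ = - (complex.Im (u t) * (sqn (u t))^-1)); last first.
    by case: (u t).
  over.
by apply: measurable_funN; exact: measurable_funM.
Qed.

End ComplexMeasurable.
Section SquareIntegrable.
Context d (T : measurableType d) (R : realType) (P : probability T R).
Implicit Types (f g : T -> R) (u v : T -> R[i]).

Lemma ae_le_integrable f g : measurable_fun setT f ->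
  P.-integrable setT (EFin \o g) -> (\forall t \ae P, `|f t| <= g t) ->
  P.-integrable setT (EFin \o f).
Proof.
move=> mf /integrableP[mg gfin] fg; apply/integrableP; split.
  exact/measurable_EFinP.
apply: le_lt_trans gfin; apply: ae_ge0_le_integral => //.
- by apply: measurableT_comp => //; exact/measurable_EFinP.
- exact: measurableT_comp.
- apply: filterS fg => t fgt _ /=.
  by rewrite lee_fin (le_trans fgt) // ler_norm.
Qed.

Lemma le_integrableT f g : measurable_fun setT f ->
  P.-integrable setT (EFin \o g) -> (forall t, `|f t| <= g t) ->
  P.-integrable setT (EFin \o f).
Proof. by move=> mf ig fg; apply: (ae_le_integrable mf ig); exact: nearW. Qed.

Lemma integrable_cstT (k : R) : P.-integrable setT (EFin \o (fun=> k)).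
Proof. exact: finite_measure_integrable_cst. Qed.

Lemma bounded_integrable f (M : R) : measurable_fun setT f ->
  (forall t, `|f t| <= M) -> P.-integrable setT (EFin \o f).
Proof. by move=> mf fM; apply: (le_integrableT mf (integrable_cstT M)). Qed.

Lemma Rintegral_cstT (k : R) : \int[P]_t k = k.
Proof. rewrite Rintegral_cst //=. by rewrite [X in fine X]probability_setT mulr1. Qed.

Lemma ge0_integral_Rintegral f (B : R) : measurable_fun setT f ->
  (forall t, 0 <= f t) -> (\int[P]_t (f t)%:E <= B%:E)%E ->
  P.-integrable setT (EFin \o f) /\ \int[P]_t f t <= B.
Proof.
move=> mf f0 fB.
have fi : P.-integrable setT (EFin \o f).
  apply/integrableP; split; first exact/measurable_EFinP.
  under eq_integral do rewrite /= ger0_norm //.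
  by rewrite (le_lt_trans fB) ?ltry.
split=> //; rewrite -lee_fin /Rintegral fineK //.
exact: integrable_fin_num.
Qed.

(** The bounds are extended real, so that integrability of the limit is part of
    what the lemma yields (see [ge0_integral_Rintegral]). *)
Lemma fatou_ae (h : nat -> T -> R) f (B : R) :
  (forall n, measurable_fun setT (h n)) -> measurable_fun setT f ->
  (forall n t, 0 <= h n t) -> (forall t, 0 <= f t) ->
  (forall n, (\int[P]_t (h n t)%:E <= B%:E)%E) ->
  (\forall t \ae P, h n t @[n --> \oo] --> f t) ->
  (\int[P]_t (f t)%:E <= B%:E)%E.
Proof.
move=> mh mf h0 f0 hB hf.
have mhE n : measurable_fun setT (fun t => (h n t)%:E) by exact/measurable_EFinP.
have -> : (\int[P]_t (f t)%:E = \int[P]_t limn_einf (fun n => (h n t)%:E))%E.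
  apply: ae_eq_integral => //.
  - exact/measurable_EFinP.
  - rewrite (_ : (fun t => _) = \- (fun t => limn_esup (fun n => - (h n t)%:E)))%E.
      apply: measurableT_comp => //; apply: measurable_fun_limn_esup => n.
      exact: measurableT_comp.
    apply/funext => t /=; have := limn_esupN (fun n => (h n t)%:E).
    by rewrite /comp /= => ->; rewrite oppeK.
  - apply: filterS hf => t hft _.
    by have /cvg_limn_einf_sup[-> _] : (h n t)%:E @[n --> \oo] --> (f t)%:E
      by apply: cvg_EFin => //; exact: nearW.
apply: (le_trans (fatou P measurableT mhE _)).
  by move=> n t _; rewrite lee_fin.
rewrite limn_einf_lim; apply: lime_le; first exact: is_cvg_einfs.
apply: nearW => n; apply: le_trans (hB n).
by apply: ereal_inf_lbound; exists n => /=.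
Qed.

Definition sqint u : Prop :=
  cmeasurable u /\ P.-integrable setT (EFin \o (fun t => sqn (u t))).

Lemma sqint_bounded u (M : R) : cmeasurable u -> (forall t, normc (u t) <= M) ->
  sqint u.
Proof.
move=> mu uM; split=> //; apply: (@bounded_integrable _ (M ^+ 2)).
  exact: measurable_sqn.
move=> t; rewrite ger0_norm ?sqn_ge0 // sqnE lerXn2r ?nnegrE ?normc_ge0 //.
exact: le_trans (normc_ge0 _) (uM t).
Qed.

Lemma sqintM u v (M : R) : cmeasurable u -> (\forall t \ae P, normc (u t) <= M) ->
  sqint v -> sqint (fun t => u t * v t).
Proof.
move=> mu uM [mv iv]; split; first exact: cmeasurableM.
apply: (@ae_le_integrable _ (fun t => M ^+ 2 * sqn (v t))).
- by apply: measurable_sqn; exact: cmeasurableM.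
- exact: (integrableZl measurableT (M ^+ 2) iv).
- apply: filterS uM => t uMt; rewrite ger0_norm ?sqn_ge0 // sqnM.
  rewrite ler_wpM2r ?sqn_ge0 // sqnE lerXn2r ?nnegrE ?normc_ge0 //.
  exact: le_trans (normc_ge0 _) uMt.
Qed.

Lemma sqint_conj u : sqint u -> sqint (fun t => (u t)^*).
Proof.
move=> [mu iu]; split; first exact: cmeasurable_conj.
apply: eq_integrable iu => // t _ /=.
by rewrite /sqn Re_conj Im_conj sqrrN.
Qed.

Lemma sqintZ (c : R[i]) u : sqint u -> sqint (fun t => c * u t).
Proof.
by apply: (@sqintM _ _ (normc c)); [exact: cmeasurable_cst|exact: nearW].
Qed.

Lemma sqintD u v : sqint u -> sqint v -> sqint (fun t => u t + v t).
Proof.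
move=> [mu iu] [mv iv]; split; first exact: cmeasurableD.
apply: (@le_integrableT _ (fun t => 2 * sqn (u t) + 2 * sqn (v t))).
- by apply: measurable_sqn; exact: cmeasurableD.
- exact: (integrableD measurableT (integrableZl measurableT 2 iu)
    (integrableZl measurableT 2 iv)).
- by move=> t; rewrite ger0_norm ?sqn_ge0 // sqnD_le2.
Qed.

Lemma sqintB u v : sqint u -> sqint v -> sqint (fun t => u t - v t).
Proof.
move=> iu iv; apply: sqintD => //.
rewrite (_ : (fun t => - v t) = (fun t => -1 * v t)); first exact: sqintZ.
by apply/funext => t; rewrite mulN1r.
Qed.

Lemma integrable_ReM u v : sqint u -> sqint v ->
  P.-integrable setT (EFin \o (fun t => complex.Re (u t * v t))).
Proof.
move=> [mu iu] [mv iv].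
apply: (@le_integrableT _ (fun t => 2^-1 * (sqn (u t) + sqn (v t)))).
- by case: (cmeasurableM mu mv).
- exact: (integrableZl measurableT 2^-1 (integrableD measurableT iu iv)).
- by move=> t; rewrite (le_trans (normr_Re_le _)) // normcM_le.
Qed.

Lemma Rintegral_sqn_ge0 u : 0 <= \int[P]_t sqn (u t).
Proof. by apply: Rintegral_ge0 => t _; exact: sqn_ge0. Qed.

(** A quadratic polynomial in [s] that stays nonnegative has a nonpositive
    discriminant. *)
Lemma cauchy_schwarz_Re u v : sqint u -> sqint v ->
  (\int[P]_t complex.Re (u t * v t)) ^+ 2 <=
  (\int[P]_t sqn (u t)) * (\int[P]_t sqn (v t)).
Proof.
move=> iu iv; have iuv := integrable_ReM iu iv.
set I := \int[P]_t _; set U := \int[P]_t _; set V := \int[P]_t _.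
have quad s : 0 <= s ^+ 2 * U + 2 * s * I + V.
  rewrite [leRHS](_ : _ = \int[P]_t sqn (s%:C * u t + (v t)^*)).
    exact: Rintegral_sqn_ge0.
  case: iu iv => _ iu [_ iv].
  have i1 := integrableZl measurableT (s ^+ 2) iu.
  have i2 := integrableZl measurableT (2 * s) iuv.
  under [RHS]eq_Rintegral do rewrite sqn_real_linear.
  rewrite RintegralD //; last exact: (integrableD measurableT i1 i2).
  by rewrite RintegralD // !RintegralZl.
have [U0|U0] := eqVneq U 0; last first.
  have Up : 0 < U by rewrite lt0r U0 Rintegral_sqn_ge0.
  (* The minimum of the quadratic polynomial. *)
  have := quad (- I / U).
  have -> : (- I / U) ^+ 2 * U + 2 * (- I / U) * I + V = (U * V - I ^+ 2) / U.
    by field.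
  by rewrite pmulr_lge0 ?invr_gt0 // subr_ge0.
rewrite U0 mul0r; have [->|I0] := eqVneq I 0; first by rewrite expr0n.
(* For U = 0 the polynomial is affine, and takes the value -1 here. *)
have := quad (- (V + 1) / (2 * I)); rewrite U0 mulr0 add0r.
have -> : 2 * (- (V + 1) / (2 * I)) * I + V = -1 by field.
by rewrite ler0N1.
Qed.

(** By Cauchy-Schwarz, pairing with a fixed square integrable [v] is continuous
    for the [L2] norm, so relations of orthogonality pass to [L2] limits. *)
Lemma ReM_integral_eq0_limit u v : sqint u -> sqint v ->
  (forall e : R, 0 < e -> exists w, [/\ sqint w,
    \int[P]_t sqn (u t - w t) <= e & \int[P]_t complex.Re (w t * v t) = 0]) ->
  \int[P]_t complex.Re (u t * v t) = 0.
Proof.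
move=> iu iv uw; apply/eqP; rewrite -sqrf_eq0 eq_le sqr_ge0 andbT.
apply/ler_addgt0Pl => e e0; rewrite addr0.
have V1 : 0 < \int[P]_t sqn (v t) + 1 by rewrite ltr_wpDl ?Rintegral_sqn_ge0.
have [|w [iw uwe wv]] := uw (e / (\int[P]_t sqn (v t) + 1)); first exact: divr_gt0.
rewrite -[X in X ^+ 2]subr0 -wv.
rewrite -RintegralB ?integrable_ReM //.
under eq_Rintegral.
  move=> t _.
  rewrite (_ : _ - _ = complex.Re ((u t - w t) * v t)); last first.
    by case: (u t) (w t) (v t) => [? ?] [? ?] [? ?] /=; ring.
  over.
apply: le_trans (cauchy_schwarz_Re (sqintB iu iw) iv) _.
apply: le_trans (ler_wpM2r (Rintegral_sqn_ge0 _) uwe) _.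
by rewrite mulrAC ler_pdivrMr // ler_wpM2l ?ltW // ltrDl.
Qed.

End SquareIntegrable.
(** * Almost everywhere convergence of rapidly Cauchy sequences *)

Section RapidlyCauchy.
Context d (T : measurableType d) (R : realType) (P : probability T R).

Lemma cvgn_dominated_increments (x y : R ^nat) :
  (forall n, `|x n.+1 - x n| <= y n) -> cvgn (series y) -> cvgn x.
Proof.
move=> xy cy.
have : cvgn (series (telescope x)).
  have y0 n : 0 <= y n := le_trans (normr_ge0 _) (xy n).
  apply: normed_cvg; apply: series_le_cvg cy => n; [exact: normr_ge0|exact: y0|exact: xy].
move=> cx; rewrite (_ : x = (fun n => x 0%N + series (telescope x) n)).
  exact: (is_cvgD (is_cvg_cst _) cx).
by apply/funext => n; rewrite -eq_sum_telescope.
Qed.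

(** This is the step of the Riesz-Fischer theorem: the integrals of the moduli of
    the increments form a convergent series, so the series of moduli converges at
    almost every point. *)
Lemma rapidly_cauchy_ae_cvg (u : nat -> T -> R[i]) (C : R) :
  (forall n, sqint P (u n)) ->
  (forall n, \int[P]_t sqn (u n.+1 t - u n t) <= C / (8 ^ n)%:R) ->
  \forall t \ae P, cvgn (fun n => complex.Re (u n t)) /\
                   cvgn (fun n => complex.Im (u n t)).
Proof.
move=> iu uC; pose f n t := normc (u n.+1 t - u n t).
have mf n : measurable_fun setT (f n).
  by apply: measurable_normc; case: (sqintB (iu n.+1) (iu n)).
have mfE n : measurable_fun setT (fun t => (f n t)%:E) by exact/measurable_EFinP.
have f0 n t : (0 <= (f n t)%:E)%E by rewrite lee_fin normc_ge0.
have fle n : (\int[P]_t (f n t)%:E <= ((2 * (1 + C)) / (2 ^ n.+1)%:R)%:E)%E.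
  have [_ ix] := sqintB (iu n.+1) (iu n).
  (* The inequality |x| <= (1 / a + a * |x|^2) / 2 with a = 2 ^ n balances the
     bound C / 8 ^ n on the integral of |x|^2. *)
  pose a : R := (2 ^ n)%:R.
  have a0 : 0 < a by rewrite ltr0n expn_gt0.
  have i1 := integrable_cstT P (2^-1 * a^-1).
  have i2 := integrableZl measurableT (2^-1 * a) ix.
  apply: (@le_trans _ _
      (\int[P]_t (2^-1 * a^-1 + (2^-1 * a) * sqn (u n.+1 t - u n t))%:E)%E).
    apply: ge0_le_integral => //.
    - by case/integrableP: (integrableD measurableT i1 i2).
    - move=> t _; rewrite lee_fin sqnE -/(f n t).
      have := sqr_ge0 (f n t - a^-1).
      rewrite -(pmulr_rge0 _ a0) => h; rewrite -subr_ge0.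
      suff -> : 2^-1 / a + 2^-1 * a * f n t ^+ 2 - f n t =
        2^-1 * (a * (f n t - a^-1) ^+ 2) by rewrite mulr_ge0.
      by field; rewrite gt_eqF.
  rewrite (_ : (\int[P]_t _)%E =
      (\int[P]_t (2^-1 * a^-1 + (2^-1 * a) * sqn (u n.+1 t - u n t)))%:E); last first.
    rewrite /Rintegral fineK //.
    exact: integrable_fin_num (integrableD measurableT i1 i2).
  rewrite lee_fin RintegralD // Rintegral_cstT RintegralZl //.
  have h := uC n.
  have C0 : 0 <= C.
    have := le_trans (Rintegral_sqn_ge0 P (fun t => u n.+1 t - u n t)) h.
    by rewrite pmulr_lge0 // invr_gt0 ltr0n expn_gt0.
  apply: le_trans (_ : 2^-1 / a + 2^-1 * a * (C / (8 ^ n)%:R) <= _).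
    by rewrite lerD2l ler_wpM2l // mulr_ge0 // ltW.
  rewrite (_ : (8 ^ n)%:R = a ^+ 3); last by rewrite -natrX -expnM mulnC expnM.
  rewrite expnS natrM -/a -subr_ge0.
  have -> : 2 * (1 + C) / (2 * a) - (2^-1 / a + 2^-1 * a * (C / a ^+ 3)) =
    2^-1 / a + C / a * (1 - 2^-1 / a) by field; rewrite gt_eqF.
  have a1 : 1 <= a by rewrite ler1n expn_gt0.
  apply: addr_ge0; first by rewrite divr_ge0 // ltW.
  apply: mulr_ge0; first by rewrite divr_ge0 // ltW.
  by rewrite subr_ge0 ler_pdivrMr // mul1r; lra.
have sfin : (\int[P]_t (\sum_(0 <= n <oo) (f n t)%:E) < +oo)%E.
  rewrite integral_nneseries //.
  apply: le_lt_trans (_ : (2 * (1 + C))%:E < +oo)%E; last by rewrite ltry.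
  apply: le_trans (_ : (\sum_(0 <= n <oo) ((2 * (1 + C)) / (2 ^ n.+1)%:R)%:E <= _)%E).
    by apply: lee_nneseries => n *; [exact: integral_ge0|exact: fle].
  apply: epsilon_trick0; rewrite mulr_ge0 // addr_ge0 //.
  have := le_trans (Rintegral_sqn_ge0 P (fun t => u 1%N t - u 0%N t)) (uC 0%N).
  by rewrite expn0 divr1.
have sint : P.-integrable setT (fun t => \sum_(0 <= n <oo) (f n t)%:E)%E.
  apply/integrableP; split.
    exact: ge0_emeasurable_sum.
  under eq_integral do rewrite gee0_abs ?nneseries_ge0 //.
  exact: sfin.
have := integrable_ae measurableT sint; apply: filterS => t /(_ I) tfin.
have cf : cvgn (series (f^~ t)).
  by apply: nnseries_is_cvg => [n|]; [exact: normc_ge0|rewrite ltey_eq tfin].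
split; apply: (cvgn_dominated_increments _ cf) => n.
  rewrite (_ : _ - _ = complex.Re (u n.+1 t - u n t)) ?normr_Re_le //.
  by case: (u n.+1 t) (u n t) => ? ? [].
rewrite (_ : _ - _ = complex.Im (u n.+1 t - u n t)) ?normr_Im_le //.
by case: (u n.+1 t) (u n t) => ? ? [].
Qed.

End RapidlyCauchy.
(** * Polynomials on the circle *)

Section CircleIntegrals.
Context {R : realType}.
Implicit Types (p q : {poly R[i]}) (c : R[i]) (t : R).
Local Notation mu := (@arc_length R).
Local Notation T := (measurableTypeR R).

#[local] Instance ae_arc_filter : Filter (almost_everywhere mu).
Proof. exact: ae_filter_ringOfSetsType. Qed.

Lemma ae_arc_mono (A B : R -> Prop) : (forall t, A t -> B t) ->
  (\forall t \ae mu, A t) -> \forall t \ae mu, B t.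
Proof. by move=> AB; exact: (@filterS _ _ ae_arc_filter A B AB). Qed.

Lemma ae_arc_and (A B : R -> Prop) : (\forall t \ae mu, A t) ->
  (\forall t \ae mu, B t) -> \forall t \ae mu, A t /\ B t.
Proof. exact: (@filterI _ _ ae_arc_filter A B). Qed.

Lemma sqn_expi t : sqn (expi t) = 1.
Proof. by rewrite /sqn /= cos2Dsin2. Qed.

Lemma normc_expi t : normc (expi t) = 1.
Proof. by rewrite normcE_sqn sqn_expi sqrtr1. Qed.

Lemma expi0 : expi (0 : R) = 1.
Proof. by rewrite /expi cos0 sin0. Qed.

Lemma expiD s t : expi (s + t) = expi s * expi t :> R[i].
Proof.
by apply/eqP; rewrite eq_complex /= cosD sinD eqxx addrC eqxx.
Qed.

Lemma expiX t n : expi t ^+ n = expi (n%:R * t).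
Proof.
elim: n => [|n IH]; first by rewrite expr0 mul0r expi0.
by rewrite exprS IH -expiD -[n.+1]add1n natrD mulrDl mul1r.
Qed.

Lemma measurable_cos_affine (k b : R) :
  measurable_fun setT (fun t : T => cos (k * t + b)).
Proof.
apply: (measurableT_comp (continuous_measurable_fun (@continuous_cos R))).
by apply: measurable_funD => //; exact: measurable_funM.
Qed.

Lemma cmeasurable_expi : cmeasurable (fun t : T => expi t).
Proof.
by split; apply: continuous_measurable_fun;
  [exact: continuous_cos|exact: continuous_sin].
Qed.

Lemma cmeasurable_horner p : cmeasurable (fun t : T => p.[expi t]).
Proof.
elim/poly_ind: p => [|p c IH].
  under eq_fun do rewrite horner0; exact: cmeasurable_cst.
under eq_fun do rewrite hornerMXaddC.
apply: cmeasurableD; last exact: cmeasurable_cst.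
by apply: cmeasurableM => //; exact: cmeasurable_expi.
Qed.

Lemma horner_circle_bounded p : exists M : R, forall t, normc p.[expi t] <= M.
Proof.
elim/poly_ind: p => [|p c [M IH]].
  by exists 0 => t; rewrite horner0 normc0.
exists (M + normc c) => t; rewrite hornerMXaddC.
by rewrite (le_trans (le_normcD _ _)) // lerD2r normcM normc_expi mulr1.
Qed.

Lemma sqint_horner p : sqint mu (fun t => p.[expi t]).
Proof.
have [M pM] := horner_circle_bounded p.
exact: sqint_bounded (cmeasurable_horner p) pM.
Qed.

Lemma integrable_cos_affine (k b : R) :
  mu.-integrable setT (EFin \o (fun t => cos (k * t + b))).
Proof.
by apply: (@bounded_integrable _ _ _ _ _ 1) => [|t];
  [exact: measurable_cos_affine|exact: cos_max].
Qed.

Lemma Rintegral_cos_affine (n : nat) (b : R) : (0 < n)%N ->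
  \int[mu]_t cos (n%:R * t + b) = 0.
Proof.
move=> n0; have n0' : n%:R != 0 :> R by rewrite pnatr_eq0 -lt0n.
have mf : measurable_fun setT (fun t : T => (1 + cos (n%:R * t + b))%:E).
  apply/measurable_EFinP; apply: measurable_funD => //.
  exact: measurable_cos_affine.
pose F (t : R) : R := t + n%:R^-1 * sin (n%:R * t + b).
have dF (t : R) : is_derive t 1 F (1 + cos (n%:R * t + b)).
  apply: is_derive_eq; rewrite /GRing.scale /= mulr1 addr0.
  by rewrite mulrCA mulVf // mulr1.
have cF : continuous F.
  move=> t; apply: differentiable_continuous; apply/derivable1_diffP.
  by case: (dF t).
have h : \int[mu]_t (1 + cos (n%:R * t + b)) = 1.
  (* The change of variables for the uniform law asks for a nonnegative
     integrand, hence the added constant 1. *)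
  have f0 (t : T) : (0 <= (1 + cos (n%:R * t + b))%:E)%E.
    by rewrite lee_fin; have := cos_geN1 (n%:R * t + b); lra.
  rewrite /Rintegral (integral_uniform _ mf f0).
  rewrite (@continuous_FTC2 _ _ F) ?twopi_gt0 //.
  - rewrite /F mulr0 add0r.
    have -> : sin (n%:R * (2 * pi) + b) = sin b :> R.
      rewrite addrC (_ : n%:R * (2 * pi) = (pi *+ 2) *+ n); last first.
        by rewrite -[RHS]mulr_natl -[pi *+ 2]mulr_natl.
      exact: (periodicn (@sinD2pi R)).
    rewrite -EFinD -EFinM /= subr0 add0r addrK mulVf //.
    by rewrite gt_eqF // twopi_gt0.
  - apply: continuous_subspaceT => t; apply: continuousD; first exact: cvg_cst.
    apply: (@continuous_comp _ _ _ (fun t : R => n%:R * t + b) cos).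
      apply: continuousD; last exact: cvg_cst.
      by apply: continuousM; [exact: cvg_cst|exact: cvg_id].
    exact: continuous_cos.
  - split.
    + by move=> t _; case: (dF t).
    + by apply: cvg_at_right_filter; exact: cF.
    + by apply: cvg_at_left_filter; exact: cF.
  - by move=> t _; rewrite derive1E; apply: derive_val.
move: h; rewrite RintegralD //; last 2 first.
- exact: integrable_cstT.
- exact: integrable_cos_affine.
by rewrite Rintegral_cstT => /(congr1 (fun x => x - 1)); rewrite addrAC subrr add0r.
Qed.

(** The phase [pi / 2] turns the sine into a cosine, so that integrals of
    [cos (n t + b)] with an arbitrary phase [b] cover all Fourier coefficients. *)
Lemma Re_mul_expi c t :
  complex.Re (c * expi t) =
  complex.Re c * cos t + complex.Im c * cos (t + pi / 2).
Proof. by case: c => a b; rewrite /= cosDpihalf mulrN. Qed.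

Lemma Rintegral_Re_expiX c (n : nat) : (0 < n)%N ->
  \int[mu]_t complex.Re (c * expi t ^+ n) = 0.
Proof.
move=> n0; under eq_Rintegral do rewrite expiX Re_mul_expi.
have i0 := integrable_cos_affine n%:R 0.
have i1 := integrable_cos_affine n%:R (pi / 2).
have j0 := integrableZl measurableT (complex.Re c) i0.
have j1 := integrableZl measurableT (complex.Im c) i1.
under eq_Rintegral do rewrite -[X in _ * cos X + _]addr0.
by rewrite RintegralD // !RintegralZl // !Rintegral_cos_affine // !mulr0 addr0.
Qed.

Lemma integrable_Re c p :
  mu.-integrable setT (EFin \o (fun t => complex.Re (c * p.[expi t]))).
Proof.
apply: integrable_ReM; last exact: sqint_horner.
by apply: (@sqint_bounded _ _ _ _ _ (normc c)) => // ; exact: cmeasurable_cst.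
Qed.

(** The real part with a free factor [c] encodes a complex integral: [c = 1] gives
    its real part and [c = - 'i] its imaginary part. *)
Lemma Rintegral_Re_horner_eq0 c p : p.[0] = 0 ->
  \int[mu]_t complex.Re (c * p.[expi t]) = 0.
Proof.
elim/poly_ind: p c => [|p a IH] c.
  move=> _; under eq_Rintegral do rewrite horner0 mulr0.
  by rewrite Rintegral_cstT.
rewrite hornerMXaddC mulr0 add0r => ->; rewrite polyC0 addr0 => {IH}.
suff mean0 q (n : nat) : \int[mu]_t complex.Re (c * (q.[expi t] * expi t ^+ n.+1)) = 0.
  under eq_Rintegral do rewrite hornerM hornerX -[X in _ * (_ * X)]expr1.
  exact: mean0.
elim/poly_ind: q n => [|q b IH] n.
  by under eq_Rintegral do rewrite horner0 mul0r mulr0; rewrite Rintegral_cstT.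
under eq_Rintegral => t _.
  rewrite hornerMXaddC mulrDl -mulrA -exprS mulrDr Re_add [c * (b * _)]mulrA.
  over.
rewrite RintegralD ?IH ?Rintegral_Re_expiX ?addr0 //.
- apply: eq_integrable (integrable_Re c (q * 'X^(n.+2))) => // t _ /=.
  by rewrite hornerM hornerXn.
- apply: eq_integrable (integrable_Re (c * b) 'X^(n.+1)) => // t _ /=.
  by rewrite hornerXn.
Qed.

End CircleIntegrals.
(** * Taylor polynomials approximate Hardy functions on the circle *)

Section ComplexConvergence.
Context {R : realType}.
Implicit Types (u v : nat -> R[i]) (z w : R[i]).

(** Convergence of complex sequences by components, which is the form consumed by
    measurability and by Fatou's lemma. *)
Definition ccvg u z : Prop :=
  (fun n => complex.Re (u n)) @ \oo --> complex.Re z /\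
  (fun n => complex.Im (u n)) @ \oo --> complex.Im z.

Lemma normC_normc z : `|z| = (normc z)%:C.
Proof. by rewrite normc_def normcE_sqn. Qed.

Lemma cvg_ReIm (I : Type) (G : set_system I) (FG : Filter G) (u : I -> R[i]) z :
  (u x : R[i]^o) @[x --> G] --> (z : R[i]^o) ->
  complex.Re (u x) @[x --> G] --> complex.Re z /\
  complex.Im (u x) @[x --> G] --> complex.Im z.
Proof.
move=> /cvgrPdist_lt uz.
have {uz}uz e : 0 < e -> \forall x \near G, normc (z - u x) < e.
  move=> e0; have ec : 0 < e%:C :> R[i] by rewrite ltcR.
  by near=> n; rewrite -ltcR -normC_normc; near: n; exact: uz ec.
split; apply/cvgrPdist_lt => e /uz; apply: filterS => n; apply: le_lt_trans => {uz}.
  rewrite (_ : _ - _ = complex.Re (z - u n)) ?normr_Re_le //.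
  by move: (u n) z => [? ?] [? ?].
rewrite (_ : _ - _ = complex.Im (z - u n)) ?normr_Im_le //.
by move: (u n) z => [? ?] [? ?].
Unshelve. all: by end_near. Qed.

Lemma ccvg_of_cvg u z : (u : nat -> R[i]^o) @ \oo --> (z : R[i]^o) -> ccvg u z.
Proof. exact: cvg_ReIm. Qed.

Lemma ccvg_cst z : ccvg (fun=> z) z.
Proof. by split; exact: cvg_cst. Qed.

Lemma ccvgD u v z w : ccvg u z -> ccvg v w -> ccvg (fun n => u n + v n) (z + w).
Proof.
move=> [u1 u2] [v1 v2]; split; rewrite ?Re_add ?Im_add.
  by under eq_fun do rewrite Re_add; exact: cvgD.
by under eq_fun do rewrite Im_add; exact: cvgD.
Qed.

Lemma ReM z w : complex.Re (z * w) =
  complex.Re z * complex.Re w - complex.Im z * complex.Im w.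
Proof. by case: z w => ? ? []. Qed.

Lemma ImM z w : complex.Im (z * w) =
  complex.Re z * complex.Im w + complex.Im z * complex.Re w.
Proof. by case: z w => ? ? []. Qed.

Lemma ccvgM u v z w : ccvg u z -> ccvg v w -> ccvg (fun n => u n * v n) (z * w).
Proof.
move=> [u1 u2] [v1 v2]; split; rewrite ?ReM ?ImM.
  by under eq_fun do rewrite ReM; apply: cvgB; exact: cvgM.
by under eq_fun do rewrite ImM; apply: cvgD; exact: cvgM.
Qed.

Lemma ccvgB u v z w : ccvg u z -> ccvg v w -> ccvg (fun n => u n - v n) (z - w).
Proof.
move=> uz vw; rewrite -mulN1r; under eq_fun do rewrite -[- v _]mulN1r.
by apply: ccvgD => //; apply: ccvgM => //; exact: ccvg_cst.
Qed.

Lemma ccvg_horner (p : {poly R[i]}) u z :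
  ccvg u z -> ccvg (fun n => p.[u n]) p.[z].
Proof.
move=> uz; elim/poly_ind: p => [|p c IH].
  by under eq_fun do rewrite horner0; rewrite horner0; exact: ccvg_cst.
rewrite hornerMXaddC; under eq_fun do rewrite hornerMXaddC.
by apply: ccvgD; [exact: ccvgM|exact: ccvg_cst].
Qed.

Lemma cvg_sqn u z : ccvg u z -> (fun n => sqn (u n)) @ \oo --> sqn z.
Proof. by move=> [u1 u2]; apply: cvgD; rewrite ?expr2; apply: cvgM. Qed.

Lemma cmeasurable_ccvg d (T : measurableType d) (u : nat -> T -> R[i]) (v : T -> R[i]) :
  (forall n, cmeasurable (u n)) -> (forall t, ccvg (u^~ t) (v t)) -> cmeasurable v.
Proof.
move=> mu uv; split.
  apply: (measurable_fun_cvg (h := fun n t => complex.Re (u n t))) => [n|t _].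
    by case: (mu n).
  by case: (uv t).
apply: (measurable_fun_cvg (h := fun n t => complex.Im (u n t))) => [n|t _].
  by case: (mu n).
by case: (uv t).
Qed.

End ComplexConvergence.

Section HardyApproximation.
Context {R : realType}.
Implicit Types (a : nat -> R[i]) (F f : R[i] -> R[i]).
Local Notation mu := (@arc_length R).
Local Notation T := (measurableTypeR R).

(** One step of Parseval's identity: multiplication by the variable preserves the
    modulus on the circle, and [p * 'X] is orthogonal to the constants. *)
Lemma Rintegral_sqn_MXaddC (p : {poly R[i]}) (c : R[i]) :
  \int[mu]_t sqn (p * 'X + c%:P).[expi t] =
  \int[mu]_t sqn p.[expi t] + sqn c.
Proof.
have [_ ip] := sqint_horner p.
have ic := integrable_Re c^* (p * 'X).
under eq_Rintegral => t _.
  rewrite (_ : sqn _ = sqn p.[expi t] + (2 * complex.Re (c^* * (p * 'X).[expi t]) + sqn c)).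
    over.
  have <- : sqn (p.[expi t] * expi t) = sqn p.[expi t].
    by rewrite sqnM sqn_expi mulr1.
  rewrite hornerMXaddC hornerM hornerX.
  by move: (_ * expi t) {ic} => z; case: z c => [? ?] [? ?]; rewrite /sqn /=; ring.
have i2 := integrableZl measurableT 2 ic.
rewrite RintegralD //; last first.
  exact: (integrableD measurableT i2 (integrable_cstT mu (sqn c))).
rewrite [X in _ + X = _]RintegralD //; last exact: (integrable_cstT mu (sqn c)).
rewrite RintegralZl // Rintegral_Re_horner_eq0 ?mulr0 ?add0r ?Rintegral_cstT //.
by rewrite hornerM hornerX mulr0.
Qed.

Lemma sqn_horner0_le (p : {poly R[i]}) : sqn p.[0] <= \int[mu]_t sqn p.[expi t].
Proof.
elim/poly_ind: p => [|p c _].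
  by rewrite horner0 sqn0 Rintegral_sqn_ge0.
by rewrite Rintegral_sqn_MXaddC hornerMXaddC mulr0 add0r lerDr Rintegral_sqn_ge0.
Qed.

Lemma parseval_poly a (N : nat) :
  \int[mu]_t sqn (\poly_(i < N) a i).[expi t] = \sum_(i < N) sqn (a i).
Proof.
elim: N a => [|N IH] a.
  under eq_Rintegral do rewrite poly_def big_ord0 horner0 sqn0.
  by rewrite Rintegral_cstT big_ord0.
rewrite big_ord_recl addrC -(IH (fun i => a i.+1)) -Rintegral_sqn_MXaddC.
suff -> : \poly_(i < N.+1) a i = (\poly_(i < N) a i.+1) * 'X + (a 0)%:P by [].
apply/polyP => -[|i].
  by rewrite coefD coefMX coefC !coef_poly /= add0r.
by rewrite coefD coefMX coefC !coef_poly /= addr0.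
Qed.

Lemma horner_poly_nat a (N : nat) (z : R[i]) :
  (\poly_(i < N) a i).[z] = \sum_(0 <= i < N) a i * z ^+ i.
Proof. by rewrite horner_poly big_mkord. Qed.

Lemma normc_circle_radius (r t : R) : 0 <= r -> normc (r%:C * expi t) = r.
Proof.
by move=> r0; rewrite normcM normc_expi mulr1 normcE_sqn sqn_real sqrtr_sqr ger0_norm.
Qed.

Definition tail2 a (N : nat) : R :=
  limn (series (fun n => normc (a n) ^+ 2)) - series (fun n => normc (a n) ^+ 2) N.

Lemma taylor_ccvg a F (r t : R) : is_taylor_disc a F -> 0 <= r < 1 ->
  ccvg (fun M => (\poly_(i < M) a i).[r%:C * expi t]) (F (r%:C * expi t)).
Proof.
move=> aF /andP[r0 r1].
have := aF (r%:C * expi t); rewrite normc_circle_radius // => /(_ r1) h.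
apply: ccvg_of_cvg; rewrite (_ : (fun M => _) = series (fun n => a n * (r%:C * expi t) ^+ n)) //.
by apply/funext => M; rewrite horner_poly_nat.
Qed.

Lemma cmeasurable_horner_radius (p : {poly R[i]}) (r : R) :
  cmeasurable (fun t : T => p.[r%:C * expi t]).
Proof.
elim/poly_ind: p => [|p c IH].
  under eq_fun do rewrite horner0; exact: cmeasurable_cst.
under eq_fun do rewrite hornerMXaddC.
apply: cmeasurableD; last exact: cmeasurable_cst.
apply: cmeasurableM => //; apply: cmeasurableM; first exact: cmeasurable_cst.
exact: cmeasurable_expi.
Qed.

Lemma cmeasurable_radius a F (r : R) : is_taylor_disc a F -> 0 <= r < 1 ->
  cmeasurable (fun t : T => F (r%:C * expi t)).
Proof.
move=> aF r01; apply: (@cmeasurable_ccvg _ _ _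
    (fun M t => (\poly_(i < M) a i).[r%:C * expi t])) => [M|t].
  exact: cmeasurable_horner_radius.
exact: taylor_ccvg.
Qed.

Lemma tail2_ge a (N m : nat) : cvgn (series (fun n => normc (a n) ^+ 2)) ->
  \sum_(N <= i < N + m) sqn (a i) <= tail2 a N.
Proof.
move=> ca; rewrite /tail2 lerBrDl.
have -> : series (fun n => normc (a n) ^+ 2) N + \sum_(N <= i < N + m) sqn (a i) =
    series (fun n => normc (a n) ^+ 2) (N + m)%N.
  rewrite /series /= [RHS](@big_cat_nat _ _ _ N 0 (N + m)) ?leq_addr //=.
  by congr (_ + _); apply: eq_bigr => i _; rewrite sqnE.
apply: nondecreasing_cvgn_le => //.
by apply: nondecreasing_series => i _ _; exact: sqr_ge0.
Qed.

(** Parseval bounds the difference of two partial sums on the circle of radius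
    [r], uniformly in [r]; Fatou's lemma lets the longer one tend to [F]. *)
Lemma taylor_circle_tail a F (r : R) (N : nat) : is_taylor_disc a F ->
  cvgn (series (fun n => normc (a n) ^+ 2)) -> 0 <= r < 1 ->
  (\int[mu]_t (sqn (F (r%:C * expi t) -
     (\poly_(i < N) a i).[r%:C * expi t]))%:E <= (tail2 a N)%:E)%E.
Proof.
move=> aF ca r01.
(* The coefficients of z |-> F (r z) with the first N removed. *)
pose b (i : nat) := (if (i < N)%N then 0 else a i) * r%:C ^+ i.
have bE m t : (\poly_(i < N + m) a i).[r%:C * expi t] -
    (\poly_(i < N) a i).[r%:C * expi t] = (\poly_(i < N + m) b i).[expi t].
  rewrite !horner_poly_nat (@big_cat_nat _ _ _ N 0 (N + m)) ?leq_addr //=.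
  rewrite [X in X - _]addrC addrK.
  rewrite [RHS](@big_cat_nat _ _ _ N 0 (N + m)) ?leq_addr //=.
  rewrite [X in _ = X + _]big1_seq ?add0r; last first.
    by move=> i /=; rewrite mem_index_iota /b => /andP[_ ->]; rewrite !mul0r.
  apply: eq_big_nat => i /andP[Ni _].
  by rewrite /b ltnNge Ni /= exprMn mulrA.
apply: (@fatou_ae _ _ _ mu (fun m t => sqn ((\poly_(i < N + m) b i).[expi t]))).
- by move=> m; apply: measurable_sqn; exact: cmeasurable_horner.
- apply: measurable_sqn; apply: cmeasurableB.
    exact: cmeasurable_radius aF r01.
  exact: cmeasurable_horner_radius.
- by move=> *; exact: sqn_ge0.
- by move=> *; exact: sqn_ge0.
- move=> m; have [_ ip] := sqint_horner (\poly_(i < N + m) b i).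
  rewrite -[leLHS]fineK ?(integrable_fin_num measurableT ip) // lee_fin.
  rewrite [leLHS](parseval_poly b (N + m)).
  apply: le_trans (tail2_ge N m ca).
  rewrite -(big_mkord xpredT (fun i => sqn (b i))).
  rewrite (@big_cat_nat _ _ _ N 0 (N + m)) ?leq_addr //=.
  rewrite big1_seq ?add0r; last first.
    by move=> i /=; rewrite mem_index_iota /b => /andP[_ ->]; rewrite mul0r sqn0.
  rewrite big_nat_cond [leRHS]big_nat_cond; apply: ler_sum => i /andP[/andP[Ni _] _].
  rewrite /b ltnNge Ni /= sqnM ler_piMr ?sqn_ge0 //.
  rewrite -rmorphXn /= sqn_real -exprM exprn_ile1 //; by case/andP: r01 => // _ /ltW.
- apply: nearW => t; under eq_fun do rewrite -bE.
  apply: cvg_sqn; apply: ccvgB; last exact: ccvg_cst.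
  have [c1 c2] := taylor_ccvg t aF r01.
  split.
    by under eq_fun do rewrite addnC; move: c1; rewrite -(cvg_shiftn N).
  by under eq_fun do rewrite addnC; move: c2; rewrite -(cvg_shiftn N).
Qed.

(** A second use of Fatou's lemma, along radii increasing to [1], transfers the
    bound to the boundary values. *)
Lemma boundary_circle_tail a F f (N : nat) : is_taylor_disc a F ->
  cvgn (series (fun n => normc (a n) ^+ 2)) -> boundary_value F f ->
  cmeasurable (fun t : T => f (expi t)) ->
  (\int[mu]_t (sqn (f (expi t) - (\poly_(i < N) a i).[expi t]))%:E
     <= (tail2 a N)%:E)%E.
Proof.
move=> aF ca Ff mf; pose r (m : nat) : R := 1 - harmonic m.
have r01 m : 0 <= r m < 1.
  rewrite subr_ge0 /harmonic /= ltrBlDr ltrDl invr_gt0 ltr0Sn andbT.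
  by rewrite invf_le1 // ler1n.
have r1 : r @ \oo --> (1 : R).
  by rewrite -[X in _ --> X]subr0; apply: cvgB; [exact: cvg_cst|exact: cvg_harmonic].
apply: (@fatou_ae _ _ _ mu (fun m t => sqn (F ((r m)%:C * expi t) -
     (\poly_(i < N) a i).[(r m)%:C * expi t]))).
- move=> m; apply: measurable_sqn; apply: cmeasurableB.
    exact: cmeasurable_radius aF (r01 m).
  exact: cmeasurable_horner_radius.
- by apply: measurable_sqn; apply: cmeasurableB => //; exact: cmeasurable_horner.
- by move=> *; exact: sqn_ge0.
- by move=> *; exact: sqn_ge0.
- by move=> m; exact: taylor_circle_tail.
- apply: ae_arc_mono Ff => t ct.
  have [cR cI] := cvg_ReIm _ ct.
  apply: cvg_sqn; apply: ccvgB.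
    split.
      by move/cvg_at_leftP: cR; apply; split => // m; case/andP: (r01 m).
    by move/cvg_at_leftP: cI; apply; split => // m; case/andP: (r01 m).
  apply: ccvg_horner; rewrite -[X in ccvg _ X]mul1r.
  by apply: ccvgM; [split => //; exact: cvg_cst|exact: ccvg_cst].
Qed.

Lemma L2_sqint f : L2 f <-> sqint mu (fun t => f (expi t)).
Proof.
have E : (\int[mu]_t `|(normc (f (expi t)))%:E| `^ 2 =
          \int[mu]_t `|(sqn (f (expi t)))%:E|)%E.
  apply: eq_integral => t _; rewrite !gee0_abs ?lee_fin ?normc_ge0 ?sqn_ge0 //.
  by rewrite poweR_EFin powR_mulrn ?normc_ge0 // sqnE.
split=> [[mf fN]|[mf /integrableP[_ fi]]]; split=> //.
  apply/integrableP; split; first by apply/measurable_EFinP; exact: measurable_sqn.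
  rewrite /= -E -(powR_Lnorm mu (fun t => (normc (f (expi t)))%:E)) //.
  exact: poweR_lty.
rewrite /finite_norm; apply: (@lty_poweRy _ _ 2) => //.
by rewrite powR_Lnorm //= E.
Qed.

(** The class [A] records a constraint on the value at the origin, such as
    [p.[0] = 0] or [p.[0] = 1], which the values of [f] on the circle do not show
    directly. *)
Definition L2_closure (A : set {poly R[i]}) f : Prop :=
  sqint mu (fun t => f (expi t)) /\
  forall e : R, 0 < e -> exists2 p, A p &
    \int[mu]_t sqn (f (expi t) - p.[expi t]) <= e.

Lemma taylor_at0 a F : is_taylor_disc a F -> F 0 = a 0%N.
Proof.
move=> aF; have := taylor_ccvg (0 : R) aF (_ : 0 <= 0 < 1).
rewrite lexx ltr01 mul0r => /(_ isT).
have E M : (\poly_(i < M.+1) a i).[0] = a 0%N by rewrite horner_coef0 coef_poly.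
move=> [cR cI]; apply/eqP; rewrite eq_complex; apply/andP; split; apply/eqP.
  move: cR; rewrite -cvg_shiftS; under eq_fun do rewrite E.
  by move=> /cvg_unique; apply => //; exact: cvg_cst.
move: cI; rewrite -cvg_shiftS; under eq_fun do rewrite E.
by move=> /cvg_unique; apply => //; exact: cvg_cst.
Qed.

Lemma hardy2_L2_closure F f : L2 f -> hardy2_disc F -> boundary_value F f ->
  L2_closure [set p | p.[0] = F 0] f.
Proof.
move=> /L2_sqint if2 [a [aF ca]] Ff; split=> // e e0.
have : (fun N => tail2 a N) @ \oo --> (0 : R).
  rewrite -(subrr (limn (series (fun n => normc (a n) ^+ 2)))).
  by apply: cvgB => //; exact: cvg_cst.
move=> /cvgrPdist_lt /(_ _ e0) [N _ /(_ N.+1 (leqnSn _)) /=].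
rewrite sub0r normrN => tN; exists (\poly_(i < N.+1) a i).
  rewrite /= horner_coef0 coef_poly /=.
  exact/esym/taylor_at0.
have mB : measurable_fun setT (fun t : T => sqn (f (expi t) -
    (\poly_(i < N.+1) a i).[expi t])).
  by apply: measurable_sqn; apply: cmeasurableB if2.1 (cmeasurable_horner _).
have [_ le_tail] := ge0_integral_Rintegral mB (fun t => sqn_ge0 _)
  (boundary_circle_tail N.+1 aF ca Ff if2.1).
by rewrite (le_trans le_tail) // (le_trans (ler_norm _)) // ltW.
Qed.

End HardyApproximation.
(** * Uniqueness of Fourier coefficients *)

Section HeavisideApproximation.
Context {R : realType}.
Implicit Types x y : R.

Lemma bernoulli_sub x (m : nat) : 0 <= x <= 1 -> 1 - m%:R * x <= (1 - x) ^+ m.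
Proof.
move=> /andP[x0 x1]; elim: m => [|m IH]; first by rewrite mul0r subr0 expr0.
rewrite exprSr; apply: le_trans (ler_wpM2r _ IH); last by rewrite subr_ge0.
have : 0 <= m%:R * x * x by rewrite !mulr_ge0.
rewrite -[m.+1]addn1 natrD; lra.
Qed.

Lemma bernoulli_add x (m : nat) : 0 <= x -> 1 + m%:R * x <= (1 + x) ^+ m.
Proof.
move=> x0; elim: m => [|m IH]; first by rewrite mul0r addr0 expr0.
rewrite exprSr; apply: le_trans (ler_wpM2r _ IH); last by rewrite addr_ge0.
have : 0 <= m%:R * x * x by rewrite !mulr_ge0.
rewrite -[m.+1]addn1 natrD; lra.
Qed.

(** From [(1 - x) ^+ m * (1 + x) ^+ m <= 1] and Bernoulli's inequality. *)
Lemma exprB_le_inv x (m : nat) : 0 < x <= 1 -> (0 < m)%N ->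
  (1 - x) ^+ m <= (m%:R * x)^-1.
Proof.
move=> /andP[x0 x1] m0; have mx0 : 0 < m%:R * x by rewrite mulr_gt0 // ltr0n.
rewrite -[leRHS]mul1r ler_pdivlMr //.
apply: (@le_trans _ _ ((1 - x) ^+ m * (1 + x) ^+ m)).
  rewrite ler_wpM2l ?exprn_ge0 ?subr_ge0 //.
  by apply: le_trans (bernoulli_add m (ltW x0)); rewrite lerDr.
rewrite -exprMn exprn_ile1 //.
  by rewrite mulr_ge0 // ?subr_ge0 // addr_ge0 // ltW.
by have := sqr_ge0 x; nra.
Qed.

(** Polynomials that tend to [0] on [[0, 1/2)] and to [1] on [(1/2, 1]]: by
    Bernoulli's inequality [(1 - y ^+ n) ^+ (2 ^ n)] is at least [1 - (2 y) ^+ n],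
    and at most [(2 y) ^- n]. *)
Definition heaviside_poly (n : nat) y : R := 1 - (1 - y ^+ n) ^+ (2 ^ n).

Lemma heaviside_poly_itv n y : 0 <= y <= 1 -> 0 <= heaviside_poly n y <= 1.
Proof.
move=> /andP[y0 y1]; have h : 0 <= 1 - y ^+ n by rewrite subr_ge0 exprn_ile1.
rewrite subr_ge0 exprn_ile1 //=; last by rewrite lerBlDr lerDl exprn_ge0.
by rewrite lerBlDr lerDl exprn_ge0.
Qed.

Lemma cvg_heaviside_poly y : 0 <= y <= 1 -> y != 2^-1 ->
  (fun n => heaviside_poly n y) @ \oo --> ((2^-1 < y)%R%:R : R).
Proof.
move=> y01 yn; have /andP[y0 y1] := y01.
have [yl|yl] := ltP 2^-1 y.
  rewrite -[X in _ --> X]subr0; apply: cvgB; first exact: cvg_cst.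
  have z1 : `|(2 * y)^-1| < 1.
    by rewrite ger0_norm ?invr_ge0 ?mulr_ge0 // invf_lt1; lra.
  apply: squeeze_cvgr (cvg_cst 0) (cvg_expr z1); apply: nearW => n.
  have yn0 : 0 < y ^+ n by rewrite exprn_gt0 //; lra.
  rewrite exprn_ge0 ?subr_ge0 ?exprn_ile1 //=.
  rewrite exprVn exprMn -natrX exprB_le_inv ?expn_gt0 //.
  by rewrite yn0 exprn_ile1.
have {yn}yl : y < 2^-1 by rewrite lt_neqAle yn.
have z1 : `|2 * y| < 1 by rewrite ger0_norm ?mulr_ge0 //; lra.
apply: squeeze_cvgr (cvg_cst 0) (cvg_expr z1); apply: nearW => n.
have /andP[-> _] := heaviside_poly_itv n y01; rewrite /=.
rewrite /heaviside_poly exprMn -natrX.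
have := @bernoulli_sub (y ^+ n) (2 ^ n) _.
by rewrite exprn_ge0 ?exprn_ile1 // => /(_ isT); lra.
Qed.

End HeavisideApproximation.

Section TrigonometricPolynomials.
Context {R : realType}.
Implicit Types f g : R -> R.

(** A single kind of generator, with an integer frequency and a free phase, covers
    constants and sines, and is stable under products by linearization. *)
Inductive trigpoly : (R -> R) -> Prop :=
| trigpoly_cos (c b : R) (k : int) : trigpoly (fun t => c * cos (k%:~R * t + b))
| trigpoly_add f g : trigpoly f -> trigpoly g -> trigpoly (fun t => f t + g t).

Lemma trigpoly_cst c : trigpoly (fun=> c).
Proof.
rewrite (_ : (fun _ => c) = (fun t => c * cos (0%:~R * t + 0))).
  exact: trigpoly_cos.
by apply/funext => t; rewrite mul0r addr0 cos0 mulr1.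
Qed.

Lemma cosMcos (x y : R) : cos x * cos y = 2^-1 * (cos (x + y) + cos (x - y)).
Proof. by rewrite cosD cosB; field. Qed.

Lemma trigpoly_mul f g : trigpoly f -> trigpoly g -> trigpoly (fun t => f t * g t).
Proof.
move=> tf; elim: tf g => [c b k|f1 f2 _ IH1 _ IH2] g tg; last first.
  under [X in trigpoly X]eq_fun do rewrite mulrDl.
  by apply: trigpoly_add; [exact: IH1|exact: IH2].
elim: tg => [c' b' k'|g1 g2 _ IH1 _ IH2]; last first.
  under [X in trigpoly X]eq_fun do rewrite mulrDr.
  exact: trigpoly_add.
pose h (s : int) (b'' : R) t := (c * c' / 2) * cos (s%:~R * t + b'').
rewrite (_ : (fun t => _) = (fun t => h (k + k') (b + b') t + h (k - k') (b - b') t)).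
  by apply: trigpoly_add; exact: trigpoly_cos.
apply/funext => t; rewrite mulrACA cosMcos /h mulrA -mulrDr; congr (_ * (cos _ + cos _)).
  by rewrite intrD; ring.
by rewrite intrB; ring.
Qed.

Lemma trigpoly_exp f n : trigpoly f -> trigpoly (fun t => f t ^+ n).
Proof.
move=> tf; elim: n => [|n IH].
  by under [X in trigpoly X]eq_fun do rewrite expr0; exact: trigpoly_cst.
by under [X in trigpoly X]eq_fun do rewrite exprS; exact: trigpoly_mul.
Qed.

Lemma trigpoly_opp f : trigpoly f -> trigpoly (fun t => - f t).
Proof.
move=> tf; under [X in trigpoly X]eq_fun do rewrite -mulN1r.
by apply: trigpoly_mul => //; exact: trigpoly_cst.
Qed.

Lemma trigpoly_heaviside f n : trigpoly f ->
  trigpoly (fun t => heaviside_poly n (f t)).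
Proof.
move=> tf; apply: trigpoly_add; first exact: trigpoly_cst.
apply: trigpoly_opp; apply: trigpoly_exp; apply: trigpoly_add.
  exact: trigpoly_cst.
by apply: trigpoly_opp; exact: trigpoly_exp.
Qed.

End TrigonometricPolynomials.
Section DensityMeasure.
Context d (T : measurableType d) (R : realType) (P : {measure set T -> \bar R}).
Variable f : T -> R.
Hypotheses (mf : measurable_fun setT f) (f0 : forall t, 0 <= f t).

(** The two proofs are arguments so that the measure structure can be attached to
    the set function itself. *)
Definition density_measure of measurable_fun setT f & (forall t, 0 <= f t) :=
  fun A : set T => (\int[P]_(t in A) (f t)%:E)%E.
Local Notation nu := (density_measure mf f0).

Let nu0 : nu set0 = 0%E.
Proof. by rewrite /density_measure integral_set0. Qed.

Let nu_ge0 A : (0 <= nu A)%E.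
Proof. by apply: integral_ge0 => t _; rewrite lee_fin. Qed.

Let nu_sigma_additive : semi_sigma_additive nu.
Proof.
move=> /= F mF tF mUF; rewrite /density_measure; apply: cvg_toP.
  apply: ereal_nondecreasing_is_cvgn => m n mn.
  apply: lee_sum_nneg_natr => // k _ _.
  by apply: integral_ge0 => t _; rewrite lee_fin.
rewrite ge0_integral_bigcup //=.
- by apply: measurable_funTS; exact/measurable_EFinP.
- by move=> t _; rewrite lee_fin.
Qed.

HB.instance Definition _ := isMeasure.Build _ _ _ nu nu0 nu_ge0 nu_sigma_additive.

End DensityMeasure.

Section DensityUniqueness.
Context {R : realType} (P : probability (measurableTypeR R) R).
Implicit Types f g : R -> R.
Local Notation T := (measurableTypeR R).

Lemma density_unique_rays f g :
  P.-integrable setT (EFin \o (f : T -> R)) -> 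
  P.-integrable setT (EFin \o (g : T -> R)) ->
  (forall t, 0 <= f t) -> (forall t, 0 <= g t) ->
  (forall a, (\int[P]_(t in `]a, +oo[) (f t)%:E =
              \int[P]_(t in `]a, +oo[) (g t)%:E)%E) ->
  \forall t \ae P, f t = g t.
Proof.
move=> fi gi f0 g0 fg.
have mf : measurable_fun [set: T] (f : T -> R).
  by apply/measurable_EFinP; case/integrableP: fi.
have mg : measurable_fun [set: T] (g : T -> R).
  by apply/measurable_EFinP; case/integrableP: gi.
have fin (A : set T) : measurable A -> (\int[P]_(t in A) (f t)%:E < +oo)%E.
  move=> mA; apply: le_lt_trans (_ : \int[P]_t (f t)%:E < +oo)%E.
    by apply: ge0_subset_integral => //; [exact/measurable_EFinP|
      move=> t _; rewrite lee_fin].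
  by apply: integrable_lty.
have E (A : set T) : measurable A ->
    density_measure P mf f0 A = density_measure P mg g0 A.
  apply: (@measure_unique _ R T (@RGenOInfty.G R) (fun k => `]- k%:R, +oo[%classic)).
  - exact: RGenOInfty.measurableE.
  - move=> _ _ [x ->] [y ->]; exists (Num.max x y).
    by apply/seteqP; split=> t /=; rewrite !in_itv /= !andbT gt_max => /andP.
  - by move=> i; exists (- i%:R).
  - apply/seteqP; split=> // t _; exists (Num.truncn `|t|).+1 => //=.
    rewrite in_itv /= andbT ltrNl; apply: le_lt_trans (truncnS_gt _).
    by rewrite -normrN ler_norm.
  - by move=> _ [x ->]; exact: fg.
  - by move=> k; apply: fin; exact: measurable_itv.
have := @integral_ae_eq _ _ _ P setT measurableT (EFin \o g) (EFin \o f) fi.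
have mgE : measurable_fun [set: T] (EFin \o (g : T -> R)) by exact/measurable_EFinP.
move=> /(_ mgE) /(_ _) h; have aeF := ae_filter_ringOfSetsType P.
apply: (filterS _ (h _)) => [t /(_ I) []//|A _ mA].
exact: E.
Qed.

End DensityUniqueness.
Section FourierUniqueness.
Context {R : realType}.
Local Notation mu := (@arc_length R).
Local Notation T := (measurableTypeR R).
Implicit Types f phi : R -> R.

Lemma trigpoly_measurable f : trigpoly f -> measurable_fun [set: T] (f : T -> R).
Proof.
elim=> [c b k|f1 f2 _ m1 _ m2]; last exact: measurable_funD.
by apply: measurable_funM => //; exact: measurable_cos_affine.
Qed.

Lemma trigpoly_bounded f : trigpoly f -> exists M : R, forall t, `|f t| <= M.
Proof.
elim=> [c b k|f1 f2 _ [M1 b1] _ [M2 b2]].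
  by exists `|c| => t; rewrite normrM ler_piMr // cos_max.
by exists (M1 + M2) => t; rewrite (le_trans (ler_normD _ _)) // lerD.
Qed.

Lemma integrable_bounded_mul (phi f : T -> R) (M : R) :
  mu.-integrable setT (EFin \o phi) -> (forall t, 0 <= phi t) ->
  measurable_fun setT f -> (forall t, `|f t| <= M) ->
  mu.-integrable setT (EFin \o (fun t => phi t * f t)).
Proof.
move=> ip p0 mf fM; apply: (@le_integrableT _ _ _ _ _ (fun t => M * phi t)).
- apply: measurable_funM => //.
  by apply/measurable_EFinP; case/integrableP: ip.
- exact: (integrableZl measurableT M ip).
- by move=> t; rewrite normrM mulrC (ger0_norm (p0 t)) ler_wpM2r.
Qed.

Lemma integrable_trigpoly_mul (phi : T -> R) f :
  mu.-integrable setT (EFin \o phi) -> (forall t, 0 <= phi t) -> trigpoly f ->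
  mu.-integrable setT (EFin \o (fun t : T => phi t * f t)).
Proof.
move=> ip p0 tf; have [M fM] := trigpoly_bounded tf.
exact: (integrable_bounded_mul ip p0 (trigpoly_measurable tf) fM).
Qed.

(** The phase [b] makes cosine and sine coefficients one condition. *)
Definition only_mean_frequency (phi : T -> R) : Prop :=
  forall (n : nat) (b : R), (0 < n)%N ->
    \int[mu]_t (phi t * cos (n%:R * t + b)) = 0.

Lemma only_mean_frequency1 : only_mean_frequency (fun=> 1).
Proof.
move=> n b n0; under eq_Rintegral do rewrite mul1r.
exact: Rintegral_cos_affine.
Qed.

(** The factor [1] on the right makes the two sides instances of the same
    computation, for the densities [phi] and [1]. *)
Lemma Rintegral_mul_trigpoly (phi : T -> R) f :
  mu.-integrable setT (EFin \o phi) -> (forall t, 0 <= phi t) ->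
  only_mean_frequency phi -> trigpoly f ->
  \int[mu]_t (phi t * f t) = (\int[mu]_t phi t) * \int[mu]_t (1 * f t).
Proof.
move=> ip p0 pc tf; have i1 := integrable_cstT mu (1 : R).
elim: tf => [c b k|f1 f2 t1 IH1 t2 IH2]; last first.
  under eq_Rintegral do rewrite mulrDr.
  under [X in _ = _ * X]eq_Rintegral do rewrite mulrDr.
  rewrite !RintegralD //; first by rewrite IH1 IH2 [RHS]mulrDr.
  - exact: (integrable_trigpoly_mul i1).
  - exact: (integrable_trigpoly_mul i1).
  - exact: integrable_trigpoly_mul.
  - exact: integrable_trigpoly_mul.
pose C (psi : T -> R) := mu.-integrable setT (EFin \o psi) /\
  (forall t, 0 <= psi t) /\ only_mean_frequency psi.
have H psi : C psi -> \int[mu]_t (psi t * (c * cos (k%:~R * t + b))) =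
    (\int[mu]_t psi t) * (if k == 0 then c * cos b else 0).
  move=> [ipsi [s0 sc]].
  have ic (l : int) : mu.-integrable setT
      (EFin \o (fun t : T => psi t * cos (l%:~R * t + b))).
    have := integrable_trigpoly_mul ipsi s0 (trigpoly_cos 1 b l).
    by apply: eq_integrable => // t _ /=; rewrite mul1r.
  under eq_Rintegral do rewrite mulrCA.
  rewrite RintegralZl //.
  case: k => [[|n]|n].
  - rewrite (_ : \int[mu]_t _ = \int[mu]_t (cos b * psi t)); last first.
      by apply: eq_Rintegral => t _; rewrite mul0r add0r mulrC.
    by rewrite RintegralZl // eqxx; ring.
  - by rewrite [X in _ * X](sc n.+1) // !mulr0.
  - rewrite mulr0 [X in _ * X](_ : _ = 0) ?mulr0 // -[RHS](sc n.+1 (- b)) //.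
    apply: eq_Rintegral => t _; congr (_ * _).
    by rewrite NegzE -[LHS]cosN; congr cos; rewrite mulrNz mulNr opprD opprK.
rewrite H // H; last first.
  by split=> //; split => // ; exact: only_mean_frequency1.
by rewrite Rintegral_cstT mul1r.
Qed.

Lemma ae_arc_interior (a : R) : \forall t \ae mu, 0 < t < 2 * pi /\ t <> a.
Proof.
have null1 (x : R) : mu [set x] = 0%E.
  apply: (@dominates_uniform_prob _ _ _ (@twopi_gt0 R) [set x]) => //.
  - move=> A mA Ax; have := @lebesgue_measure_set1 R x => l0.
    apply/eqP; rewrite eq_le measure_ge0 andbT -l0.
    by apply: le_measure => //; rewrite inE.
have ae1 (x : R) : \forall t \ae mu, t <> x.
  exists [set x]; split => // t /=; exact: contrapT.
have aeI : \forall t \ae mu, t \in `[0, 2 * pi].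
  exists (~` `[0, 2 * pi]%classic); split => //.
  - exact: measurableC.
  - rewrite /= /arc_length /uniform_prob integral_uniform_pdf.
    by rewrite setICl integral_set0.
apply: ae_arc_mono (ae_arc_and (ae_arc_and (ae1 0) (ae1 (2 * pi)))
  (ae_arc_and (ae1 a) aeI)) => t [[/eqP t0 /eqP t2] [ta]].
rewrite in_itv /= => /andP[h0 h2].
by split=> //; rewrite !lt_neqAle h0 h2 t2 eq_sym t0.
Qed.

(** By [ray_trigE] this is the product [sin (t / 2) * sin ((t - a) / 2)], which on
    the open period has the sign of [t - a], rescaled into the unit interval so
    that the sign change occurs at the value [1 / 2]. *)
Definition ray_trig (a t : R) : R := 2^-1 + 4^-1 * (cos (a / 2) - cos (t - a / 2)).

Lemma ray_trigE a t : ray_trig a t = 2^-1 + 2^-1 * (sin (t / 2) * sin ((t - a) / 2)).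
Proof.
rewrite /ray_trig; have -> : a / 2 = t / 2 - (t - a) / 2 by lra.
have -> : t - (t / 2 - (t - a) / 2) = t / 2 + (t - a) / 2 by lra.
by rewrite cosB cosD; lra.
Qed.

Lemma ray_trig_itv a t : 0 <= ray_trig a t <= 1.
Proof.
have := cos_geN1 (a / 2); have := cos_le1 (a / 2).
have := cos_geN1 (t - a / 2); have := cos_le1 (t - a / 2).
rewrite /ray_trig => h1 h2 h3 h4; apply/andP; split; lra.
Qed.

Lemma trigpoly_ray_trig a : trigpoly (ray_trig a).
Proof.
rewrite (_ : ray_trig a = (fun t => (2^-1 + 4^-1 * cos (a / 2)) +
  (- 4^-1) * cos (1%:~R * t + - (a / 2)))).
  by apply: trigpoly_add; [exact: trigpoly_cst|exact: trigpoly_cos].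
by apply/funext => t; rewrite /ray_trig mul1r; ring.
Qed.

Lemma cvg_ray_trig a t : 0 <= a < 2 * pi -> 0 < t < 2 * pi -> t <> a ->
  (fun n => heaviside_poly n (ray_trig a t)) @ \oo --> ((a < t)%R%:R : R).
Proof.
move=> /andP[a0 a2] /andP[t0 t2] /eqP ta.
have st : 0 < sin (t / 2) by apply: sin_gt0_pi; apply/andP; split; lra.
have pos : a < t -> 0 < sin ((t - a) / 2).
  by move=> at'; apply: sin_gt0_pi; apply/andP; split; lra.
have neg : t < a -> sin ((t - a) / 2) < 0.
  move=> at'; rewrite -oppr_gt0 -sinN.
  by apply: sin_gt0_pi; apply/andP; split; lra.
have sgn : (2^-1 < ray_trig a t) = (a < t).
  rewrite ray_trigE ltrDl pmulr_rgt0 ?invr_gt0 // pmulr_rgt0 //.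
  case: (ltgtP a t) ta => // [h _|h _]; first exact: pos.
  by apply/negbTE; rewrite -leNgt ltW // neg.
have ne : ray_trig a t != 2^-1.
  rewrite ray_trigE -subr_eq0 addrC addKr mulf_neq0 ?invr_neq0 // mulf_neq0 //.
    by rewrite gt_eqF.
  by case: (ltgtP a t) ta => // [h _|h _]; [rewrite gt_eqF // pos|rewrite lt_eqF // neg].
by rewrite -sgn; exact: cvg_heaviside_poly (ray_trig_itv a t) ne.
Qed.

Lemma measurable_ray (a : R) : measurable_fun [set: T] (fun t : T => ((a < t)%R%:R : R)).
Proof.
rewrite (_ : (fun t => _) = (\1_(`]a, +oo[%classic) : T -> R)).
  exact: measurable_indic.
apply/funext => t; rewrite indicE; congr (_%:R); congr nat_of_bool.
by apply/idP/idP; rewrite inE /= in_itv /= andbT.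
Qed.

Lemma integrable_ray_mul (phi : T -> R) (a : R) :
  mu.-integrable setT (EFin \o phi) -> (forall t, 0 <= phi t) ->
  mu.-integrable setT (EFin \o (fun t : T => phi t * (a < t)%R%:R)).
Proof.
move=> ip p0; apply: (@integrable_bounded_mul _ _ 1 ip p0 (measurable_ray a)) => t.
by case: ltP => _; rewrite ?normr1 ?normr0.
Qed.

Lemma integral_ray (phi : T -> R) (a : R) :
  mu.-integrable setT (EFin \o phi) -> (forall t, 0 <= phi t) ->
  (\int[mu]_(t in `]a, +oo[) (phi t)%:E =
   (\int[mu]_t (phi t * (a < t)%R%:R))%:E)%E.
Proof.
move=> ip p0; rewrite /Rintegral fineK; last first.
  exact: integrable_fin_num (integrable_ray_mul a ip p0).
rewrite [LHS]integral_mkcond; apply: eq_integral => t _; rewrite patchE.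
have -> : (t \in `]a, +oo[%classic) = (a < t).
  by apply/idP/idP; rewrite inE /= in_itv /= andbT.
by case: ltP => _; rewrite ?mulr1 ?mulr0.
Qed.

Lemma Rintegral_ray_ae (phi : T -> R) (a c : R) :
  mu.-integrable setT (EFin \o phi) -> (forall t, 0 <= phi t) ->
  (\forall t \ae mu, (a < t)%R%:R = c) ->
  \int[mu]_t (phi t * (a < t)%R%:R) = c * \int[mu]_t phi t.
Proof.
move=> ip p0 ac; rewrite -RintegralZl // /Rintegral; congr fine.
apply: ae_eq_integral => //.
- by case/integrableP: (integrable_ray_mul a ip p0).
- by case/integrableP: (integrableZl measurableT c ip).
- by apply: ae_arc_mono ac => t <- _; rewrite mulrC.
Qed.

Lemma cvg_Rintegral_ray (phi : T -> R) (a : R) : 0 <= a < 2 * pi ->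
  mu.-integrable setT (EFin \o phi) -> (forall t, 0 <= phi t) ->
  (fun n => \int[mu]_t (phi t * heaviside_poly n (ray_trig a t))) @ \oo -->
  \int[mu]_t (phi t * (a < t)%R%:R).
Proof.
move=> a02 ip p0.
have mphi : measurable_fun setT phi.
  by apply/measurable_EFinP; case/integrableP: ip.
have mray := measurable_ray a.
have mT n : measurable_fun [set: T] (fun t : T => heaviside_poly n (ray_trig a t)).
  by apply: trigpoly_measurable; exact: trigpoly_heaviside (trigpoly_ray_trig a).
have := @dominated_convergence _ T R mu setT measurableT
  (fun n t => (phi t * heaviside_poly n (ray_trig a t))%:E)
  (fun t => (phi t * (a < t)%R%:R)%:E) (EFin \o phi).
case.
- by move=> n; apply/measurable_EFinP; exact: measurable_funM.
- by apply/measurable_EFinP; exact: measurable_funM.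
- apply: ae_arc_mono (ae_arc_interior a) => t [t02 ta] _.
  apply: cvg_EFin; first exact: nearW.
  by apply: cvgM; [exact: cvg_cst|exact: cvg_ray_trig].
- exact: ip.
- apply: nearW => t n _; rewrite lee_fin normrM (ger0_norm (p0 t)).
  have /andP[h0 h1] := heaviside_poly_itv n (ray_trig_itv a t).
  by rewrite (ger0_norm h0) ler_piMr.
move=> il _ c; rewrite /Rintegral; apply: fine_cvg.
by rewrite fineK //; exact: integrable_fin_num.
Qed.

(** Over a ray starting in the period, both densities integrate as limits of their
    integrals against [heaviside_poly n (ray_trig a t)], which agree by
    [Rintegral_mul_trigpoly]; the other rays are null or of full measure. *)
Lemma fourier_unique (phi : T -> R) : mu.-integrable setT (EFin \o phi) ->
  (forall t, 0 <= phi t) -> only_mean_frequency phi ->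
  \forall t \ae mu, phi t = \int[mu]_s phi s.
Proof.
move=> ip p0 pc; set I := \int[mu]_s phi s.
have I0 : 0 <= I by exact: Rintegral_ge0.
have i1 := integrable_cstT mu (1 : R).
have key (a : R) : \int[mu]_t (phi t * (a < t)%R%:R) =
    I * \int[mu]_t (1 * (a < t)%R%:R).
  have const_case (c : R) : (\forall t \ae mu, (a < t)%R%:R = c) ->
      \int[mu]_t (phi t * (a < t)%R%:R) = I * \int[mu]_t (1 * (a < t)%R%:R).
    move=> ac; rewrite !(@Rintegral_ray_ae _ _ c) // Rintegral_cstT mulr1.
    exact: mulrC.
  have [a0|a0] := ltP a 0.
    apply: (const_case 1); apply: ae_arc_mono (ae_arc_interior 0).
    by move=> t [/andP[t0 _] _]; rewrite (lt_trans a0 t0).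
  have [a2|a2] := ltP a (2 * pi); last first.
    apply: (const_case 0); apply: ae_arc_mono (ae_arc_interior 0).
    by move=> t [/andP[_ t2] _]; rewrite ltNge ltW // (lt_le_trans t2).
  have a02 : 0 <= a < 2 * pi by rewrite a0 a2.
  have c1 := cvg_Rintegral_ray a02 ip p0.
  have c2 := @cvg_Rintegral_ray (fun=> 1) a a02 i1 (fun=> ler01).
  apply: (cvg_unique _ c1) => //.
  rewrite (_ : (fun n => _) = (fun n => I *
    \int[mu]_t (1 * heaviside_poly n (ray_trig a t)))).
    by apply: cvgM => //; exact: cvg_cst.
  apply/funext => n; apply: Rintegral_mul_trigpoly => //.
  exact: trigpoly_heaviside (trigpoly_ray_trig a).
apply: (@density_unique_rays _ mu phi (fun=> I)) => // [|a].
  exact: integrable_cstT.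
rewrite !integral_ray //; last exact: integrable_cstT.
rewrite key -RintegralZl //; last exact: (integrable_ray_mul a i1).
by congr (_%:E); apply: eq_Rintegral => t _; rewrite mul1r.
Qed.

End FourierUniqueness.
(** * Szego's extremal problem and outer functions *)

Section SzegoExtremal.
Context {R : realType}.
Local Notation mu := (@arc_length R).
Local Notation T := (measurableTypeR R).
Variables (w : T -> R) (M : R).
Hypotheses (mw : measurable_fun setT w) (w_ge1 : forall t, 1 <= w t)
  (w_le : forall t, w t <= M).
Implicit Types (u v : T -> R[i]) (p q m : {poly R[i]}).

Definition weighted u : R := \int[mu]_t (sqn (u t) * w t).
Local Notation Q := weighted.

Let w_ge0 t : 0 <= w t.
Proof. exact: le_trans ler01 (w_ge1 t). Qed.

Lemma integrable_weighted u : sqint mu u ->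
  mu.-integrable setT (EFin \o (fun t => sqn (u t) * w t)).
Proof.
move=> [_ iu]; apply: (integrable_bounded_mul (M := M) iu) => // t.
  exact: sqn_ge0.
by rewrite ger0_norm.
Qed.

Lemma le_Rintegral_weighted u : sqint mu u -> \int[mu]_t sqn (u t) <= Q u.
Proof.
move=> iu; apply: le_Rintegral => //; first by case: iu.
  exact: integrable_weighted.
by move=> t _; rewrite ler_peMr ?sqn_ge0.
Qed.

Lemma weighted_le u : sqint mu u -> Q u <= M * \int[mu]_t sqn (u t).
Proof.
move=> iu; case: (iu) => _ iu2; rewrite -RintegralZl //.
apply: le_Rintegral => //; first exact: integrable_weighted.
  exact: (integrableZl measurableT M iu2).
by move=> t _; rewrite mulrC ler_wpM2r ?sqn_ge0.
Qed.

Lemma weighted_ge0 u : 0 <= Q u.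
Proof. by apply: Rintegral_ge0 => t _; rewrite mulr_ge0 ?sqn_ge0. Qed.

Lemma weighted_parallelogram u v : sqint mu u -> sqint mu v ->
  Q (fun t => u t - v t) = 2 * Q u + 2 * Q v - Q (fun t => u t + v t).
Proof.
move=> iu iv.
have i1 := integrableZl measurableT 2 (integrable_weighted iu).
have i2 := integrableZl measurableT 2 (integrable_weighted iv).
have i3 := integrable_weighted (sqintD iu iv).
rewrite /weighted -(RintegralZl 2 measurableT (integrable_weighted iu)).
rewrite -(RintegralZl 2 measurableT (integrable_weighted iv)).
rewrite -(RintegralD measurableT i1 i2).
rewrite -(RintegralB measurableT (integrableD measurableT i1 i2) i3).
by apply: eq_Rintegral => t _; rewrite parallelogram; ring.
Qed.

Lemma weightedZ (c : R[i]) u : sqint mu u ->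
  Q (fun t => c * u t) = sqn c * Q u.
Proof.
move=> iu; rewrite /weighted -(RintegralZl _ measurableT (integrable_weighted iu)).
by apply: eq_Rintegral => t _; rewrite sqnM mulrA.
Qed.

Lemma weightedD_le u v (e : R) : 0 < e -> sqint mu u -> sqint mu v ->
  Q (fun t => u t + v t) <= (1 + e) * Q u + (1 + e^-1) * Q v.
Proof.
move=> e0 iu iv.
have i1 := integrableZl measurableT (1 + e) (integrable_weighted iu).
have i2 := integrableZl measurableT (1 + e^-1) (integrable_weighted iv).
rewrite /weighted -(RintegralZl (1 + e) measurableT (integrable_weighted iu)).
rewrite -(RintegralZl (1 + e^-1) measurableT (integrable_weighted iv)).
rewrite -(RintegralD measurableT i1 i2).
apply: le_Rintegral => //; first exact: integrable_weighted (sqintD iu iv).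
  exact: (integrableD measurableT i1 i2).
move=> t _; apply: le_trans (ler_wpM2r (w_ge0 t) (sqnD_le (u t) (v t) e0)) _.
by rewrite mulrDl !mulrA.
Qed.

Let ev p : T -> R[i] := fun t => p.[expi t].

Lemma weighted_horner_ge1 p : p.[0] = 1 -> 1 <= Q (ev p).
Proof.
move=> p1; rewrite -[leLHS]sqn1 -p1; apply: le_trans (sqn_horner0_le p) _.
exact: le_Rintegral_weighted (sqint_horner p).
Qed.

Definition szego_inf : R := inf [set Q (ev p) | p in [set p | p.[0] = 1]].

Lemma szego_inf_le p : p.[0] = 1 -> szego_inf <= Q (ev p).
Proof.
move=> p1; apply: ge_inf; last by exists p.
by exists 1 => _ [q q1 <-]; exact: weighted_horner_ge1.
Qed.

Lemma szego_inf_ge1 : 1 <= szego_inf.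
Proof.
apply: lb_le_inf; first by exists (Q (ev 1)), 1 => //=; rewrite hornerE.
by move=> _ [q q1 <-]; exact: weighted_horner_ge1.
Qed.

Lemma szego_minimizing : exists p : nat -> {poly R[i]}, forall n,
  (p n).[0] = 1 /\ Q (ev (p n)) <= szego_inf + (8 ^ n)%:R^-1.
Proof.
have H (n : nat) : exists q : {poly R[i]},
    q.[0] = 1 /\ Q (ev q) <= szego_inf + (8 ^ n)%:R^-1.
  have hi : has_inf [set Q (ev p) | p in [set p | p.[0] = 1]].
    split; first by exists (Q (ev 1)), 1 => //=; rewrite hornerE.
    by exists 1 => _ [q q1 <-]; exact: weighted_horner_ge1.
  have e0 : 0 < (8 ^ n)%:R^-1 :> R by rewrite invr_gt0 ltr0n expn_gt0.
  by have [_ [q q1 <-] /ltW le_q] := inf_adherent e0 hi; exists q.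
by have [p pP] := choice H; exists p.
Qed.

(** The half sum of two competitors is a competitor, so the parallelogram identity
    forces near minimizers to be near each other. *)
Lemma szego_cauchy p q (e f : R) : p.[0] = 1 -> q.[0] = 1 ->
  Q (ev p) <= szego_inf + e -> Q (ev q) <= szego_inf + f ->
  \int[mu]_t sqn (p.[expi t] - q.[expi t]) <= 2 * (e + f).
Proof.
move=> p1 q1 pe qf; have ip := sqint_horner p; have iq := sqint_horner q.
apply: le_trans (le_Rintegral_weighted (sqintB ip iq)) _.
rewrite weighted_parallelogram //.
have : 4 * szego_inf <= Q (fun t => p.[expi t] + q.[expi t]).
  have r1 : (2^-1 *: (p + q)).[0] = 1.
    by rewrite hornerZ hornerD p1 q1 mulVf // pnatr_eq0.
  have := szego_inf_le r1.
  rewrite /ev; under [X in _ <= Q X]eq_fun do rewrite hornerZ hornerD.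
  rewrite weightedZ; last exact: sqintD.
  have -> : sqn (2^-1 : R[i]) = 4^-1.
    have -> : (2^-1 : R[i]) = (2^-1)%:C by rewrite fmorphV rmorph_nat.
    by rewrite sqn_real; field.
  by lra.
move: pe qf; rewrite /ev; lra.
Qed.

(** The minimizing sequence is chosen at the rate [8 ^ n] required by
    [rapidly_cauchy_ae_cvg]; Fatou's lemma then yields both the bound on the
    limit and the convergence in [L2]. *)
Lemma szego_limit : exists F : R[i] -> R[i],
  [/\ L2_closure [set p | p.[0] = 1] F & Q (fun t => F (expi t)) <= szego_inf].
Proof.
have [p pP] := szego_minimizing.
pose eps (n : nat) : R := (8 ^ n)%:R^-1.
have eps0 n : 0 < eps n by rewrite invr_gt0 ltr0n expn_gt0.
have eps_le n k : eps (n + k)%N <= eps n.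
  by rewrite lef_pV2 ?posrE ?ltr0n ?expn_gt0 // ler_nat leq_exp2l // leq_addr.
have cau k n : \int[mu]_t sqn ((p (k + n)%N).[expi t] - (p k).[expi t]) <= 4 * eps k.
  have [p1 pe] := pP (k + n)%N; have [q1 qe] := pP k.
  apply: le_trans (szego_cauchy p1 q1 pe qe) _.
  by have := eps_le k n; rewrite /eps; lra.
(* Upper limits are measurable everywhere and agree with the limits wherever
   these exist. *)
pose F (z : R[i]) : R[i] := fine (limn_esup (fun n => (complex.Re (p n).[z])%:E))
  +i* fine (limn_esup (fun n => (complex.Im (p n).[z])%:E)).
have mF : cmeasurable (fun t : T => F (expi t)).
  split; rewrite /F /=.
    apply: (measurableT_comp (fine_measurable measurableT)).
    apply: measurable_fun_limn_esup => n; apply/measurable_EFinP.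
    by case: (cmeasurable_horner (p n)).
  apply: (measurableT_comp (fine_measurable measurableT)).
  apply: measurable_fun_limn_esup => n; apply/measurable_EFinP.
  by case: (cmeasurable_horner (p n)).
have cF : \forall t \ae mu, ccvg (fun n => (p n).[expi t]) (F (expi t)).
  have ae := @rapidly_cauchy_ae_cvg _ T R mu (fun n t => (p n).[expi t]) 4
    (fun n => sqint_horner (p n)).
  apply: ae_arc_mono (ae _) => [t [cR cI]|n]; last first.
    by have := cau n 1%N; rewrite addn1.
  split; rewrite /F /=.
    have -> : limn_esup (fun n => (complex.Re (p n).[expi t])%:E) =
        (limn (fun n => complex.Re (p n).[expi t]))%:E.
      by apply: (cvg_limn_einf_sup _).2; apply: cvg_EFin => //; exact: nearW.
    exact: cR.
  have -> : limn_esup (fun n => (complex.Im (p n).[expi t])%:E) =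
      (limn (fun n => complex.Im (p n).[expi t]))%:E.
    by apply: (cvg_limn_einf_sup _).2; apply: cvg_EFin => //; exact: nearW.
  exact: cI.
have shift k (u : nat -> R[i]) z : ccvg u z -> ccvg (fun n => u (k + n)%N) z.
  move=> [c1 c2]; split.
    by under eq_fun do rewrite addnC; move: c1; rewrite -(cvg_shiftn k).
  by under eq_fun do rewrite addnC; move: c2; rewrite -(cvg_shiftn k).
have fin_of (f : T -> R) : mu.-integrable setT (EFin \o f) ->
    (\int[mu]_t (f t)%:E = (\int[mu]_t f t)%:E)%E.
  by move=> fi; rewrite /Rintegral fineK //; exact: integrable_fin_num.
have mQF : measurable_fun setT (fun t : T => sqn (F (expi t)) * w t).
  by apply: measurable_funM => //; exact: measurable_sqn.
have QF k : mu.-integrable setT (EFin \o (fun t : T => sqn (F (expi t)) * w t)) /\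
    Q (fun t => F (expi t)) <= szego_inf + eps k.
  apply: ge0_integral_Rintegral => //; first by move=> t; rewrite mulr_ge0 ?sqn_ge0.
  apply: (@fatou_ae _ _ _ mu (fun n t => sqn ((p (k + n)%N).[expi t]) * w t)) => //.
  - move=> n; apply: measurable_funM => //; apply: measurable_sqn.
    exact: cmeasurable_horner.
  - by move=> n t; rewrite mulr_ge0 ?sqn_ge0.
  - by move=> t; rewrite mulr_ge0 ?sqn_ge0.
  - move=> n; rewrite fin_of; last exact: integrable_weighted (sqint_horner _).
    rewrite lee_fin; have [_ h] := pP (k + n)%N; apply: le_trans h _.
    by rewrite lerD2l; exact: eps_le.
  - apply: ae_arc_mono cF => t ct; apply: cvgM; last exact: cvg_cst.
    by apply: cvg_sqn; exact: (shift k (fun n => (p n).[expi t])).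
have iF : sqint mu (fun t => F (expi t)).
  split=> //; apply: le_integrableT (QF 0%N).1 _; first exact: measurable_sqn.
  by move=> t; rewrite ger0_norm ?sqn_ge0 // ler_peMr ?sqn_ge0.
have eps_small (e : R) : 0 < e -> exists k, eps k <= e.
  move=> e0; exists (Num.truncn e^-1).+1; rewrite /eps invf_ple ?posrE ?ltr0n ?expn_gt0 //.
  apply: le_trans (ltW (truncnS_gt _)) _.
  by rewrite ler_nat; apply: ltnW; exact: ltn_expl.
exists F; split.
  split=> // e e0; have [|k ke] := eps_small (e / 4); first by rewrite divr_gt0.
  exists (p k); first by case: (pP k).
  have mB : measurable_fun setT (fun t : T => sqn (F (expi t) - (p k).[expi t])).
    by apply: measurable_sqn; apply: cmeasurableB mF (cmeasurable_horner _).
  have [] := @ge0_integral_Rintegral _ _ _ mu _ (4 * eps k) mB (fun t => sqn_ge0 _).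
    apply: (@fatou_ae _ _ _ mu
      (fun n t => sqn ((p (k + n)%N).[expi t] - (p k).[expi t]))) => //.
    - move=> n; apply: measurable_sqn.
      exact: cmeasurableB (cmeasurable_horner _) (cmeasurable_horner _).
    - by move=> *; exact: sqn_ge0.
    - by move=> *; exact: sqn_ge0.
    - move=> n; rewrite fin_of ?lee_fin //.
      by case: (sqintB (sqint_horner (p (k + n)%N)) (sqint_horner (p k))).
    - apply: ae_arc_mono cF => t ct; apply: cvg_sqn; apply: ccvgB; last exact: ccvg_cst.
      exact: (shift k (fun n => (p n).[expi t])).
  by move=> _ h; apply: le_trans h _; lra.
apply/ler_addgt0Pl => e e0; have [k ke] := eps_small e e0.
by apply: le_trans (QF k).2 _; rewrite addrC lerD2r.
Qed.

(** For a polynomial [p] near [F] with [p.[0] = 1], the product [m * p] is a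
    competitor in the extremal problem. *)
Lemma szego_inf_le_mul (F : R[i] -> R[i]) m : L2_closure [set p | p.[0] = 1] F ->
  m.[0] = 1 -> szego_inf <= Q (fun t => m.[expi t] * F (expi t)).
Proof.
move=> [iF aF] m1; have [B mB] := horner_circle_bounded m.
have iM u : sqint mu u -> sqint mu (fun t => m.[expi t] * u t).
  by apply: (@sqintM _ _ _ _ _ _ B); [exact: cmeasurable_horner|exact: nearW].
have iMF := iM _ iF.
have M1 : 1 <= M := le_trans (w_ge1 0) (w_le 0).
have M0 : 0 <= M := le_trans ler01 M1.
pose K := M * B ^+ 2 + 1.
have K0 : 0 < K by rewrite ltr_wpDl // mulr_ge0 // sqr_ge0.
have approx e : 0 < e -> szego_inf <= (1 + e) * Q (fun t => m.[expi t] * F (expi t)).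
  move=> e0; apply/ler_addgt0Pl => eta eta0.
  have ee0 : 0 < 1 + e^-1 by rewrite addr_gt0 // invr_gt0.
  have [|p p1 pe] := aF (eta / ((1 + e^-1) * K)).
    by rewrite divr_gt0 // mulr_gt0.
  have mp1 : (m * p).[0] = 1 by rewrite hornerM m1 p1 mulr1.
  apply: le_trans (szego_inf_le mp1) _.
  have iFp := sqintB iF (sqint_horner p).
  have iD := iM _ iFp.
  have -> : ev (m * p) = (fun t => m.[expi t] * F (expi t) +
      -1 * (m.[expi t] * (F (expi t) - p.[expi t]))).
    by apply/funext => t; rewrite /ev hornerM; ring.
  apply: le_trans (weightedD_le e0 iMF (sqintZ (-1) iD)) _.
  rewrite addrC lerD2r weightedZ // sqnN sqn1 mul1r.
  apply: (@le_trans _ _ ((1 + e^-1) * (K * (eta / ((1 + e^-1) * K))))); last first.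
    by rewrite mulrA mulrCA mulfV ?mulr1 // gt_eqF // mulr_gt0.
  rewrite ler_pM2l //; apply: le_trans (weighted_le iD) _.
  apply: (@le_trans _ _ (M * (B ^+ 2 * \int[mu]_t sqn (F (expi t) - p.[expi t])))).
    rewrite ler_wpM2l //; case: (iFp) => _ i2.
    rewrite -RintegralZl //; apply: le_Rintegral => //; first by case: iD.
      exact: (integrableZl measurableT (B ^+ 2) i2).
    move=> t _; rewrite sqnM ler_wpM2r ?sqn_ge0 // sqnE.
    by rewrite lerXn2r ?nnegrE ?normc_ge0 // (le_trans (normc_ge0 _) (mB t)).
  rewrite mulrA; apply: ler_pM => //; first by rewrite mulr_ge0 // sqr_ge0.
    exact: Rintegral_sqn_ge0.
  by rewrite lerDl.
set q := Q _; have q0 : 0 <= q := weighted_ge0 _.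
have q1 : 0 < q + 1 by rewrite ltr_wpDl.
apply/ler_addgt0Pl => eta eta0.
apply: le_trans (approx (eta / (q + 1)) (divr_gt0 eta0 q1)) _.
rewrite -/q mulrDl mul1r addrC lerD2r mulrAC ler_pdivrMr // ler_wpM2l ?ltW //.
by rewrite ltrDl.
Qed.

Lemma sqn_1Dexpi (s x : R) : sqn (1 + s%:C * expi x) = 1 + s ^+ 2 + 2 * s * cos x.
Proof.
transitivity (1 + s ^+ 2 * (cos x ^+ 2 + sin x ^+ 2) + 2 * s * cos x).
  by rewrite /sqn /=; ring.
by rewrite cos2Dsin2 mulr1.
Qed.

(** The value at the minimum [s = - c / d] is [- c ^+ 2 / d]. *)
Lemma quadratic_ge0_eq0 (d c : R) : 0 < d ->
  (forall s, 0 <= s ^+ 2 * d + 2 * s * c) -> c = 0.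
Proof.
move=> d0 /(_ (- c / d)).
have -> : (- c / d) ^+ 2 * d + 2 * (- c / d) * c = - (c ^+ 2 / d).
  by field; rewrite gt_eqF.
rewrite oppr_ge0 pmulr_lle0 ?invr_gt0 // => c0.
by apply/eqP; rewrite -sqrf_eq0 eq_le c0 sqr_ge0.
Qed.

(** The extremal function.  Multiplying it by [1 + s e^(ib) z^n] cannot lower the
    weighted norm, and the first order term in [s] of that norm is a Fourier
    coefficient of [sqn F * w]. *)
Lemma outer_function : exists (F : R[i] -> R[i]) (d : R),
  [/\ 0 < d, L2_closure setT F & \forall t \ae mu, sqn (F (expi t)) * w t = d].
Proof.
have [F [cF QF]] := szego_limit; exists F, szego_inf.
have iF : sqint mu (fun t => F (expi t)) by case: cF.
have d0 : 0 < szego_inf := lt_le_trans ltr01 szego_inf_ge1.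
have ip := integrable_weighted iF.
have p0 (t : T) : 0 <= sqn (F (expi t)) * w t by rewrite mulr_ge0 ?sqn_ge0.
split=> //.
  by split=> // e /(proj2 cF e)[p _ pe]; exists p.
have QFE : Q (fun t => F (expi t)) = szego_inf.
  apply/eqP; rewrite eq_le QF.
  have one1 : (1 : {poly R[i]}).[0] = 1 by rewrite hornerE.
  have := szego_inf_le_mul cF one1.
  by under [X in _ <= Q X]eq_fun do rewrite hornerE mul1r.
rewrite -QFE; apply: (fourier_unique ip p0) => n b n0.
apply: (quadratic_ge0_eq0 d0) => s.
set m : {poly R[i]} := 1 + (s%:C * expi b) *: 'X^n.
have m1 : m.[0] = 1.
  by rewrite /m hornerD hornerZ hornerXn !hornerE expr0n gtn_eqF // mulr0 addr0.
have ic : mu.-integrable setT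
    (EFin \o (fun t : T => (sqn (F (expi t)) * w t) * cos (n%:R * t + b))).
  apply: (integrable_bounded_mul (M := 1) ip p0).
    exact: measurable_cos_affine.
  by move=> t; exact: cos_max.
have := szego_inf_le_mul cF m1.
rewrite (_ : Q _ = \int[mu]_t ((1 + s ^+ 2) * (sqn (F (expi t)) * w t) +
  (2 * s) * (sqn (F (expi t)) * w t * cos (n%:R * t + b)))); last first.
  apply: eq_Rintegral => t _.
  have -> : m.[expi t] = 1 + s%:C * expi (n%:R * t + b).
    by rewrite /m hornerD hornerZ hornerXn hornerC expiX -mulrA -expiD [b + _]addrC.
  by rewrite sqnM sqn_1Dexpi; ring.
rewrite RintegralD //; last 2 first.
- exact: (integrableZl measurableT (1 + s ^+ 2) ip).
- exact: (integrableZl measurableT (2 * s) ic).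
rewrite !RintegralZl // [X in (1 + s ^+ 2) * X](_ : _ = szego_inf) //.
by rewrite -[leLHS]addr0 mulrDl mul1r -addrA lerD2l.
Qed.

End SzegoExtremal.
(** * Adding a bounded analytic multiple of the inner function *)

Section BoundedAnalyticSymbols.
Context {R : realType}.
Local Notation mu := (@arc_length R).
Local Notation T := (measurableTypeR R).
Implicit Types (f g h k : R[i] -> R[i]) (c : R[i]).

Lemma sqint_horner_mul (p : {poly R[i]}) (u : T -> R[i]) : sqint mu u ->
  sqint mu (fun t => p.[expi t] * u t).
Proof.
move=> iu; have [B pB] := horner_circle_bounded p.
by apply: (@sqintM _ _ _ _ _ _ B) => //; [exact: cmeasurable_horner|exact: nearW].
Qed.

(** The three factors are replaced by polynomials one after the other; each
    replacement leaves a fixed cofactor, which is square integrable because [h]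
    is bounded. *)
Lemma analytic_product_mean0 h f k (B : R) c :
  L2_closure setT h -> (\forall t \ae mu, normc (h (expi t)) <= B) ->
  L2_closure setT f -> L2_closure [set p | p.[0] = 0] k ->
  \int[mu]_t complex.Re (c * (h (expi t) * f (expi t) * k (expi t))) = 0.
Proof.
move=> [ih ah] hB [jf af] [ik ak].
have step1 (p q : {poly R[i]}) : q.[0] = 0 ->
    \int[mu]_t complex.Re (h (expi t) * (c * (p * q).[expi t])) = 0.
  move=> q0; apply: (ReM_integral_eq0_limit ih (sqintZ c (sqint_horner (p * q)))).
  move=> e /ah[r _ re]; exists (fun t => r.[expi t]).
  split=> //; first exact: sqint_horner.
  under eq_Rintegral do rewrite mulrCA -hornerM.
  by apply: Rintegral_Re_horner_eq0; rewrite !hornerM q0 !mulr0.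
have step2 (q : {poly R[i]}) : q.[0] = 0 ->
    \int[mu]_t complex.Re (f (expi t) * (c * (q.[expi t] * h (expi t)))) = 0.
  move=> q0.
  apply: (ReM_integral_eq0_limit jf (sqintZ c (sqint_horner_mul q ih))).
  move=> e /af[p _ pe]; exists (fun t => p.[expi t]).
  split=> //; first exact: sqint_horner.
  rewrite -[RHS](step1 p q q0); apply: eq_Rintegral => t _.
  by rewrite hornerM; congr complex.Re; ring.
have ihf : sqint mu (fun t => h (expi t) * f (expi t)).
  by apply: sqintM hB jf; case: ih.
rewrite (_ : \int[mu]_t _ =
    \int[mu]_t complex.Re (k (expi t) * (c * (h (expi t) * f (expi t))))); last first.
  by apply: eq_Rintegral => t _; congr complex.Re; ring.
apply: (ReM_integral_eq0_limit ik (sqintZ c ihf)).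
move=> e /ak[q q0 qe]; exists (fun t => q.[expi t]).
split=> //; first exact: sqint_horner.
rewrite -[RHS](step2 q q0); apply: eq_Rintegral => t _.
by congr complex.Re; ring.
Qed.

Lemma H2_closure f : H2 f -> L2_closure setT f.
Proof.
move=> [L2f [F [hF Ff]]]; have [jf af] := hardy2_L2_closure L2f hF Ff.
by split=> // e /af[p _ pe]; exists p.
Qed.

Lemma H2_0_closure f : H2_0 f -> L2_closure [set p | p.[0] = 0] f.
Proof.
by move=> [L2f [F [hF F0 Ff]]]; have := hardy2_L2_closure L2f hF Ff; rewrite F0.
Qed.

Lemma dotL2_Re f g : dotL2 f g =
  (\int[mu]_t complex.Re (1 * (f (expi t) * (g (expi t))^*))) +i*
  (\int[mu]_t complex.Re (- 'i * (f (expi t) * (g (expi t))^*))).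
Proof.
rewrite /dotL2; congr (_ +i* _); apply: eq_Rintegral => t _; first by rewrite mul1r.
by case: (_ * _) => x y /=; rewrite oppr0 mul0r sub0r mulN1r opprK.
Qed.

Section ChangeOfSymbol.
Variables (theta h : R[i] -> R[i]) (B : R).
Hypotheses (htheta : inner_function theta) (ch : L2_closure setT h)
  (hB : \forall t \ae mu, normc (h (expi t)) <= B).

Lemma inner_cmeasurable : cmeasurable (fun t : T => theta (expi t)).
Proof. by case: htheta => -[]. Qed.

Lemma inner_normc1 : \forall t \ae mu, normc (theta (expi t)) = 1.
Proof. by case: htheta. Qed.

Lemma cmeasurable_theta_h : cmeasurable (fun t : T => theta (expi t) * h (expi t)).
Proof.
apply: cmeasurableM; first exact: inner_cmeasurable.
by case: ch => -[].
Qed.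

Lemma theta_h_bounded : \forall t \ae mu, normc (theta (expi t) * h (expi t)) <= B.
Proof.
apply: ae_arc_mono (ae_arc_and inner_normc1 hB) => t [t1 tB].
by rewrite normcM t1 mul1r.
Qed.

Lemma sqint_theta_h_mul (u : T -> R[i]) : sqint mu u ->
  sqint mu (fun t => theta (expi t) * h (expi t) * u t).
Proof. exact: sqintM cmeasurable_theta_h theta_h_bounded. Qed.

Lemma model_space_sqint f : model_space theta f -> sqint mu (fun t => f (expi t)).
Proof. by move=> [[/L2_sqint]]. Qed.

(** Writing [k] as [theta] times the conjugate of [l], the integrand becomes the
    analytic product [c * (h * f * l)], since [theta] is unimodular. *)
Lemma theta_h_orthogonal c f k : model_space theta f -> model_space theta k ->
  \int[mu]_t complex.Re
    (c * (theta (expi t) * h (expi t) * f (expi t) * (k (expi t))^*)) = 0.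
Proof.
move=> Kf Kk; have if2 := model_space_sqint Kf; have ik := model_space_sqint Kk.
case: Kf => H2f _; case: Kk => _ [l H2l kl].
rewrite -[RHS](analytic_product_mean0 c ch hB (H2_closure H2f) (H2_0_closure H2l)).
rewrite /Rintegral; congr fine; apply: ae_eq_integral => //.
- apply/measurable_EFinP.
  have mu1 : cmeasurable (fun t : T => c * (theta (expi t) * h (expi t) *
      f (expi t) * (k (expi t))^*)).
    apply: cmeasurableM; first exact: cmeasurable_cst.
    apply: cmeasurableM; last by apply: cmeasurable_conj; case: ik.
    by apply: cmeasurableM; [exact: cmeasurable_theta_h|case: if2].
  by case: mu1.
- apply/measurable_EFinP.
  have mu1 : cmeasurable (fun t : T => c * (h (expi t) * f (expi t) * l (expi t))).
    apply: cmeasurableM; first exact: cmeasurable_cst.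
    apply: cmeasurableM; last by case: (H2_0_closure H2l) => -[].
    by apply: cmeasurableM; [case: ch => -[]|case: if2].
  by case: mu1.
- apply: ae_arc_mono (ae_arc_and inner_normc1 kl) => t [t1 tk] _; congr (EFin (complex.Re _)).
  have tt : theta (expi t) * (theta (expi t))^* = 1.
    have : sqn (theta (expi t)) = 1 by rewrite sqnE t1 expr1n.
    case: (theta (expi t)) => x y; rewrite /sqn /= => xy.
    apply/eqP; rewrite eq_complex /= mulrN opprK -!expr2 xy eqxx /=.
    by rewrite mulrN mulrC addrC subrr.
  rewrite tk rmorphM /= conjCK.
  rewrite -[in RHS](mul1r (h _)) -tt; ring.
Qed.

Lemma L2_change_symbol g f : model_space theta f ->
  L2 (g \* f) <-> L2 ((fun z => g z + theta z * h z) \* f).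
Proof.
move=> Kf; have ihf := sqint_theta_h_mul (model_space_sqint Kf).
split=> /L2_sqint igf; apply/L2_sqint.
  rewrite (_ : (fun t => _) = (fun t : T => (g \* f) (expi t) +
      theta (expi t) * h (expi t) * f (expi t))); first exact: sqintD.
  by apply/funext => t /=; rewrite mulrDl.
rewrite (_ : (fun t => _) = (fun t : T =>
  ((fun z => g z + theta z * h z) \* f) (expi t) -
      theta (expi t) * h (expi t) * f (expi t))); first exact: sqintB.
by apply/funext => t /=; rewrite mulrDl addrK.
Qed.

Lemma dotL2_change_symbol g f v k : model_space theta f -> model_space theta v ->
  model_space theta k -> L2 (g \* f) ->
  dotL2 (((fun z => g z + theta z * h z) \* f) \- v) k = dotL2 ((g \* f) \- v) k.
Proof.
move=> Kf Kv Kk /L2_sqint igf.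
have ihf := sqint_theta_h_mul (model_space_sqint Kf).
have iv := model_space_sqint Kv; have ik := sqint_conj (model_space_sqint Kk).
rewrite !dotL2_Re.
have E c : \int[mu]_t complex.Re (c * ((((fun z => g z + theta z * h z) \* f) \- v)
      (expi t) * (k (expi t))^*)) =
    \int[mu]_t complex.Re (c * (((g \* f) \- v) (expi t) * (k (expi t))^*)).
  rewrite -[RHS]addr0 -[X in _ = _ + X](theta_h_orthogonal c Kf Kk) -RintegralD //.
  - apply: eq_Rintegral => t _; rewrite -Re_add; congr complex.Re => /=; ring.
  - have := integrable_ReM (sqintZ c (sqintB igf iv)) ik.
    by apply: eq_integrable => // t _ /=; rewrite mulrA.
  - have := integrable_ReM (sqintZ c ihf) ik.
    by apply: eq_integrable => // t _ /=; rewrite !mulrA.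
by rewrite !E.
Qed.

(** The difference of the two symbols sends the domain into the orthogonal
    complement of the model space, and it is bounded. *)
Lemma tto_change_symbol g :
  tto_dom theta g = tto_dom theta (fun z => g z + theta z * h z) /\
  tto theta g = tto theta (fun z => g z + theta z * h z).
Proof.
have dom f : tto_dom theta g f <-> tto_dom theta (fun z => g z + theta z * h z) f.
  by split=> -[Kf L2f]; split=> //; apply/(L2_change_symbol g Kf).
split; first by apply/seteqP; split=> f /dom.
apply/seteqP; split=> -[f v] /= [Df [Kv Ov]]; split.
- exact/dom.
- split=> // k Kk; case: Df => Kf L2gf.
  by rewrite dotL2_change_symbol //; exact: Ov.
- exact/dom.
- split=> // k Kk; have /dom[Kf L2gf] := Df.
  by rewrite -(dotL2_change_symbol Kf Kv Kk L2gf); exact: Ov.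
Qed.

End ChangeOfSymbol.

End BoundedAnalyticSymbols.
(** * A symbol bounded away from zero *)

Section InvertibleSymbol.
Context {R : realType}.
Local Notation mu := (@arc_length R).
Local Notation T := (measurableTypeR R).
Implicit Types (f g h : R[i] -> R[i]).

Lemma Linfty_ae_bounded f (B : R) : cmeasurable (fun t : T => f (expi t)) ->
  (\forall t \ae mu, normc (f (expi t)) <= B) -> Linfty f.
Proof.
move=> mf fB; split=> //; rewrite /finite_norm unlock.
case: ifPn => // _; apply: (@le_lt_trans _ _ B%:E); last exact: ltry.
apply/ess_sup_inf.ess_supP; apply: ae_arc_mono fB => t tB /=.
by rewrite ger0_norm ?normc_ge0.
Qed.

Definition size_weight g (t : T) : R := 1 + 3 * (3 < normc (g (expi t)))%R%:R.

Lemma size_weight_ge1 g t : 1 <= size_weight g t.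
Proof. by rewrite lerDl mulr_ge0. Qed.

Lemma size_weight_le4 g t : size_weight g t <= 4.
Proof. by rewrite /size_weight; case: ltP => _ /=; lra. Qed.

Lemma measurable_size_weight g : cmeasurable (fun t : T => g (expi t)) ->
  measurable_fun setT (size_weight g).
Proof.
move=> mg; have mn := measurable_normc mg.
apply: measurable_funD => //; apply: measurable_funM => //.
have mb : measurable_fun setT (fun t : T => 3 < normc (g (expi t))).
  exact: measurable_fun_ltr.
rewrite (_ : (fun t => _) = (fun t : T => if 3 < normc (g (expi t)) then 1 else 0)).
  exact: measurable_fun_ifT.
by apply/funext => t; case: ltP.
Qed.

(** The weight is [4] where [|g| > 3] and [1] elsewhere, so rescaling the outer
    function to [|h|^2 * w = 16] gives [|h| = 2] and [|h| = 4] respectively, at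
    distance at least [1] from [|g|] in both cases. *)
Lemma separating_function g : cmeasurable (fun t : T => g (expi t)) ->
  exists h, [/\ L2_closure setT h,
    \forall t \ae mu, normc (h (expi t)) <= 4 &
    \forall t \ae mu, 1 <= `|normc (g (expi t)) - normc (h (expi t))|].
Proof.
move=> mg.
have [F [d [d0 [iF aF] Fd]]] := outer_function (measurable_size_weight mg)
  (size_weight_ge1 g) (size_weight_le4 g).
pose kappa : R := 4 / Num.sqrt d.
have k2 : kappa ^+ 2 * d = 16.
  by rewrite exprMn exprVn sqr_sqrtr ?ltW // mulrAC -mulrA mulfV ?gt_eqF // mulr1; lra.
have hE : \forall t \ae mu,
    sqn (kappa%:C * F (expi t)) * size_weight g t = 16.
  by apply: ae_arc_mono Fd => t Ft; rewrite sqnM sqn_real -mulrA Ft.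
have hN : \forall t \ae mu, normc (kappa%:C * F (expi t)) =
    if 3 < normc (g (expi t)) then 2 else 4.
  apply: ae_arc_mono hE => t; rewrite sqnE /size_weight.
  have := normc_ge0 (kappa%:C * F (expi t)).
  by case: ltP => _ h0 /= hw; nra.
exists (fun z => kappa%:C * F z); split.
- split; first exact: sqintZ.
  move=> e e0; have K0 : 0 < kappa ^+ 2 by rewrite -(pmulr_lgt0 _ d0) k2.
  have [|p _ pe] := aF (e / kappa ^+ 2); first exact: divr_gt0.
  exists (kappa%:C *: p) => //.
  rewrite (_ : \int[mu]_t _ = \int[mu]_t (kappa ^+ 2 * sqn (F (expi t) - p.[expi t]))).
    rewrite RintegralZl //; last by case: (sqintB iF (sqint_horner p)).
    by rewrite mulrC -ler_pdivlMr.
  by apply: eq_Rintegral => t _; rewrite hornerZ -mulrBr sqnM sqn_real.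
- by apply: ae_arc_mono hN => t ->; case: ifP => _; lra.
- apply: ae_arc_mono hN => t ->; have := normc_ge0 (g (expi t)).
  case: ltP => h1 h0; first by rewrite ger0_norm; lra.
  by rewrite ler0_norm; lra.
Qed.

Lemma ler_dist_normcD (x y : R[i]) : `|normc x - normc y| <= normc (x + y).
Proof.
have h1 := le_normcD (x + y) (- y); have h2 := le_normcD (x + y) (- x).
move: h1 h2; rewrite addrK [x + y]addrC addrK !normcN => h1 h2.
by rewrite ler_norml; apply/andP; split; lra.
Qed.

End InvertibleSymbol.

Theorem proposition2p2 (R : realType) (theta : R[i] -> R[i])
    (htheta : inner_function theta) (g : R[i] -> R[i]) (hg : L2 g) :
  exists gt : R[i] -> R[i],
    [/\ L2 gt,
        tto_dom theta g = tto_dom theta gt,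
        tto theta g = tto theta gt,
        ae_circle (fun z => gt z <> 0) &
        Linfty (fun z => (gt z)^-1)].
Proof.
have /L2_sqint ig := hg.
have [h [ch hB gh]] := separating_function (proj1 ig).
exists (fun z => g z + theta z * h z).
have ith : sqint (@arc_length R) (fun t => theta (expi t) * h (expi t)).
  apply: (@sqintM _ _ _ _ _ _ 1 (inner_cmeasurable htheta)); last by case: ch.
  by apply: ae_arc_mono (inner_normc1 htheta) => t ->.
have igt := sqintD ig ith.
have gt_ge1 : \forall t \ae (@arc_length R),
    1 <= normc (g (expi t) + theta (expi t) * h (expi t)).
  apply: ae_arc_mono (ae_arc_and (inner_normc1 htheta) gh) => t [t1 t2].
  apply: le_trans t2 _; apply: le_trans (ler_dist_normcD _ _).
  by rewrite normcM t1 mul1r.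
have [domE graphE] := tto_change_symbol htheta ch hB g.
split=> //.
- exact/L2_sqint.
- apply: ae_arc_mono gt_ge1 => t h1 gt0; move: h1.
  by rewrite gt0 normc0 ler10.
- apply: (@Linfty_ae_bounded _ _ 1); first by apply: cmeasurableV; case: igt.
  apply: ae_arc_mono gt_ge1 => t h1.
  by rewrite normcV invf_le1 // (lt_le_trans ltr01).
Qed.
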